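(* Let $\alpha$ be the unique positive root of the polynomial $z^3-z-1$. Then $$\Omega(\mathrm{PGL}(2,\mathbb{Z}))=\Omega(\mathrm{GL}(2,\mathbb{Z}))=\alpha.$$
   Context: For a group $G$ generated by a finite set $S$, the length $\ell_{G,S}(g)$ of $g\in G$ is the minimal integer $n\ge 0$ such that $g=x_1x_2\cdots x_n$ with all $x_i\in S\cup S^{-1}$. Let $F_{G,S}(n)$ be the number of $g\in G$ with $\ell_{G,S}(g)\le n$. The exponential growth rate of $G$ with respect to $S$ is $\omega(G,S)=\lim_{n\to\infty}(F_{G,S}(n))^{1/n}$ (the limit always exists). The minimal exponential growth rate is $\Omega(G)=\inf_S \omega(G,S)$, the infimum being over all finite generating sets $S$ of $G$. *)

(* Defs.v *)
From HB Require Import structures.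
From mathcomp Require Import all_boot all_order all_algebra.
From mathcomp Require Import finmap.
From mathcomp Require Import all_classical all_reals all_analysis.

Set Implicit Arguments.
Unset Strict Implicit.
Unset Printing Implicit Defensive.

Import Order.TTheory GRing.Theory Num.Theory.
Import numFieldNormedType.Exports.

Local Open Scope classical_set_scope.
Local Open Scope ring_scope.

Section Growth.
Variable G : groupType.
Implicit Types (S : set G) (g : G) (n : nat).

Definition letters S : set G := S `|` [set x^-1%g | x in S].

(* [w] may be empty, so the identity is a word of length 0. *)
Definition is_product S g n : Prop :=
  exists w : seq G, [/\ size w = n,
    forall x, x \in w -> letters S x & \big[*%g/1%g]_(x <- w) x = g].

Definition generates S : Prop := forall g, exists n, is_product S g n.

(* The junk value 0 is only taken when [g] is not in the subgroup generated by
   [S], hence never when [generates S] holds. *)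
Definition word_length S g : nat :=
  if pselect (exists n, `[< is_product S g n >]) is left p then ex_minn p
  else 0%N.

Definition word_ball S n : set G := [set g | (word_length S g <= n)%N].

(* [fset_set] is the finite set underlying a set satisfying [finite_set], and is
   empty otherwise; [word_ball S n] is finite when [S] is finite and generating. *)
Definition growth S n : nat := #|` fset_set (word_ball S n)|%N.

End Growth.

(* The n-th root of a nonnegative real is rendered by the real power [`^ n^-1];
   the term n = 0, where [0^-1 = 0], is irrelevant to the limit. *)
Definition growth_rate (R : realType) (G : groupType) (S : set G) : R :=
  limn (fun n : nat => (growth S n)%:R `^ (n%:R^-1) : R).

Definition min_growth_rate (R : realType) (G : groupType) : R :=
  inf [set growth_rate R S | S in
    [set S : set G | finite_set S /\ generates S]].

Section GeneralLinear.
Variables (n : nat) (R : comUnitRingType).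

Record GL := MkGL { GLmx :> 'M[R]_n; _ : GLmx \in unitmx }.

HB.instance Definition _ := [isSub for GLmx].
HB.instance Definition _ := [Choice of GL by <:].

Lemma GLmx_unit (A : GL) : GLmx A \in unitmx.
Proof. exact: (valP A). Qed.

Definition GL_one : GL := MkGL (unitmx1 R n).

Lemma GL_mul_subproof (A B : GL) : GLmx A *m GLmx B \in unitmx.
Proof. by rewrite unitmx_mul !GLmx_unit. Qed.
Definition GL_mul (A B : GL) : GL := MkGL (GL_mul_subproof A B).

Lemma GL_inv_subproof (A : GL) : invmx (GLmx A) \in unitmx.
Proof. by rewrite unitmx_inv GLmx_unit. Qed.
Definition GL_inv (A : GL) : GL := MkGL (GL_inv_subproof A).

Lemma GL_mulA : associative GL_mul.
Proof. by move=> A B C; apply/val_inj; rewrite /= mulmxA. Qed.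
Lemma GL_mul1m : left_id GL_one GL_mul.
Proof. by move=> A; apply/val_inj; rewrite /= mul1mx. Qed.
Lemma GL_mulm1 : right_id GL_one GL_mul.
Proof. by move=> A; apply/val_inj; rewrite /= mulmx1. Qed.
Lemma GL_mulVm : left_inverse GL_one GL_inv GL_mul.
Proof. by move=> A; apply/val_inj; rewrite /= mulVmx ?GLmx_unit. Qed.
Lemma GL_mulmV : right_inverse GL_one GL_inv GL_mul.
Proof. by move=> A; apply/val_inj; rewrite /= mulmxV ?GLmx_unit. Qed.

HB.instance Definition _ :=
  isGroup.Build GL GL_mulA GL_mul1m GL_mulm1 GL_mulVm GL_mulmV.

Lemma GLmx1 : GLmx 1%g = 1%:M. Proof. by []. Qed.
Lemma GLmxM (A B : GL) : GLmx (A * B)%g = GLmx A *m GLmx B. Proof. by []. Qed.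
Lemma GLmxV (A : GL) : GLmx A^-1%g = invmx (GLmx A). Proof. by []. Qed.

End GeneralLinear.

Section ProjectiveGeneralLinear.
Variables (n : nat) (R : comUnitRingType).
Implicit Types A B C : GL n R.

(* The invertible scalar matrices over int are 1 and -1, so [PGL 2 int] below is
   the quotient of [GL 2 int] by {1, -1}. *)
Definition PGL_eqv : rel (GL n R) :=
  fun A B => is_scalar_mx (GLmx (A^-1 * B)%g).

Lemma PGL_eqvP A B :
  reflect (exists a, GLmx B = a%:M *m GLmx A) (PGL_eqv A B).
Proof.
apply: (iffP is_scalar_mxP) => -[a ABa]; exists a.
  by rewrite -scalar_mxC -ABa -GLmxM mulgA mulgV mul1g.
by rewrite GLmxM GLmxV ABa -scalar_mxC mulKmx // GLmx_unit.
Qed.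

Lemma PGL_eqv_refl : reflexive PGL_eqv.
Proof. by move=> A; apply/PGL_eqvP; exists 1; rewrite mul1mx. Qed.

Lemma PGL_eqvV A B a : GLmx B = a%:M *m GLmx A -> GLmx A = a^-1%:M *m GLmx B.
Proof.
move=> BaA; have E : a%:M = GLmx (B * A^-1)%g.
  by rewrite GLmxM BaA GLmxV mulmxK // GLmx_unit.
by rewrite -invmx_scalar E -GLmxV -GLmxM invgF mulgVK.
Qed.

Lemma PGL_eqv_sym : symmetric PGL_eqv.
Proof.
suff H A B : PGL_eqv A B -> PGL_eqv B A by move=> A B; apply/idP/idP; apply: H.
by case/PGL_eqvP=> a /PGL_eqvV E; apply/PGL_eqvP; exists a^-1.
Qed.

Lemma PGL_eqv_trans : transitive PGL_eqv.
Proof.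
move=> B A C /PGL_eqvP[a Ea] /PGL_eqvP[b Eb]; apply/PGL_eqvP.
by exists (b * a); rewrite Eb Ea mulmxA scalar_mxM.
Qed.

Canonical PGL_equiv :=
  EquivRel PGL_eqv PGL_eqv_refl PGL_eqv_sym PGL_eqv_trans.

Definition PGL : Type := {eq_quot PGL_equiv}%qT.

HB.instance Definition _ := Choice.on PGL.
HB.instance Definition _ := EqQuotient.on PGL.

Local Open Scope quotient_scope.

Definition PGL_one : PGL := lift_cst PGL 1%g.
Definition PGL_mul : PGL -> PGL -> PGL := lift_op2 PGL *%g.
Definition PGL_inv : PGL -> PGL := lift_op1 PGL (fun A => A^-1)%g.

Lemma PGL_reprP A : exists a, GLmx (repr (\pi_PGL A)) = a%:M *m GLmx A.
Proof. by apply/PGL_eqvP; rewrite -(eqmodE PGL_equiv) reprK. Qed.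

Lemma PGL_piP A B : (exists a, GLmx B = a%:M *m GLmx A) ->
  \pi_PGL A = \pi_PGL B.
Proof. by move/PGL_eqvP => ?; apply/eqmodP. Qed.

Lemma PGL_pi1 : \pi_PGL 1%g = PGL_one.
Proof. by rewrite /PGL_one -lock. Qed.

Lemma PGL_piM : {morph \pi_PGL : A B / (A * B)%g >-> PGL_mul A B}.
Proof.
move=> A B; unlock PGL_mul; apply: PGL_piP; have [a Ea] := PGL_reprP A.
have [b Eb] := PGL_reprP B; exists (a * b).
rewrite !GLmxM Ea Eb scalar_mxM -!mulmxA; congr (_ *m _).
by rewrite !mulmxA; congr (_ *m _); rewrite scalar_mxC.
Qed.

Lemma PGL_piV : {morph \pi_PGL : A / A^-1%g >-> PGL_inv A}.
Proof.
move=> A; unlock PGL_inv; apply: PGL_piP; have [a Ea] := PGL_reprP A.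
have Eb := PGL_eqvV Ea; exists a^-1; rewrite !GLmxV.
have uA := GLmx_unit A; have ur := GLmx_unit (repr (\pi_PGL A)).
by rewrite -[LHS](mulmxK uA); congr (_ *m _); rewrite Eb -scalar_mxC mulKmx.
Qed.

Lemma PGL_mulA : associative PGL_mul.
Proof.
elim/quotW=> A; elim/quotW=> B; elim/quotW=> C.
by rewrite -!PGL_piM mulgA.
Qed.
Lemma PGL_mul1m : left_id PGL_one PGL_mul.
Proof. by elim/quotW=> A; rewrite -PGL_pi1 -PGL_piM mul1g. Qed.
Lemma PGL_mulm1 : right_id PGL_one PGL_mul.
Proof. by elim/quotW=> A; rewrite -PGL_pi1 -PGL_piM mulg1. Qed.
Lemma PGL_mulVm : left_inverse PGL_one PGL_inv PGL_mul.
Proof. by elim/quotW=> A; rewrite -PGL_pi1 -PGL_piV -PGL_piM mulVg. Qed.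
Lemma PGL_mulmV : right_inverse PGL_one PGL_inv PGL_mul.
Proof. by elim/quotW=> A; rewrite -PGL_pi1 -PGL_piV -PGL_piM mulgV. Qed.

HB.instance Definition _ :=
  isGroup.Build PGL PGL_mulA PGL_mul1m PGL_mulm1 PGL_mulVm PGL_mulmV.

End ProjectiveGeneralLinear.

(* Main.v *)
Require Import Defs.
From mathcomp Require Import all_boot all_order all_algebra.
From mathcomp Require Import finmap.
From mathcomp Require Import all_classical all_reals all_analysis.
From mathcomp Require Import zify ring lra.

Set Implicit Arguments.
Unset Strict Implicit.
Unset Printing Implicit Defensive.

Import Order.TTheory GRing.Theory Num.Theory.
Import numFieldNormedType.Exports.

(** The proof rests on the action of PGL(2,Z) on the trivalent Farey tree.

    Lower bound.  The relation alpha^3 = alpha + 1 says alpha^-2 + alpha^-3 = 1,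
    so a free monoid on one word of length at most 2 and one word of length at
    most 3 grows at least like alpha^n ([growth_rate_free_pair]).  Every finite
    generating set S of PGL(2,Z) contains such a pair of words
    ([short_free_pair_exists]).  If S contains an element s acting as a
    translation of the tree, some t in S moves the axis of s, and s and
    t^-1 s t (up to inversion) play ping-pong ([hyperbolic_pair]).  Otherwise all
    elements of S are torsion, and each of them fixes a vertex or preserves an
    edge.  An element of order 3, two elements preserving the same edge, and two
    reflections with adjacent edges are treated by ping-pong at the fixed vertex
    or edge ([rotation_pair], [short_edge], [short_reflections]); in the last two
    cases a pair of lengths 2 and 3 may be needed.  In the remaining case S
    consists of involutions whose pairwise products are translations; two such
    products xy and xz with different axes play ping-pong, with lengths 2 and 2.
    Different axes occur because otherwise all of PGL(2,Z) would commensurate one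
    translation ([commensurator_not_all]).

    The tree enters only through its half-trees, which are the translates of one
    half-tree.  They are indexed by the group elements, and inclusion of
    half-trees is the left-invariant preorder attached to the submonoid of
    classes of nonnegative matrices.  The section on half-trees works in any
    group with two involutions a, b and two elements sh c satisfying the few
    identities that PGL(2,Z) is then checked to satisfy.

    Upper bound.  GL(2,Z) is generated by three involutions A, B, C lifting the
    Coxeter generators of the (2,3,infinity) triangle group.  Up to sign and
    bounded factors an element of length n is a product of the syllables CA and
    BCA, of lengths 2 and 3, with total length at most n
    ([word_ball_normal]); there are O(alpha^n) such products.  The images of
    A, B, C give the same bound in PGL(2,Z), and the lower bound passes from
    PGL(2,Z) to GL(2,Z) because growth can only decrease in a quotient
    ([growth_rate_image_le]).  All the limits exist by Fekete's lemma. *)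

Ltac gsimp := rewrite ?(mulgA, invgK, invgM, mulgVK, mulgK, mulVg, mulgV, mul1g, mulg1, invg1).

(** * Free pairs and commensurability in a group *)

Section FreePairs.
Local Open Scope group_scope.
Variable G : groupType.
Implicit Types (x y g h : G) (w : seq bool).

Definition eval_pair x y w : G := foldr (fun c p => (if c then x else y) * p) 1 w.
Definition free_pair x y := injective (eval_pair x y).

(** If x and y map the domain O into two disjoint parts of itself, the first letter of a word is
    visible on its value, and the word is recovered by left cancellation. *)
Lemma free_pair_ping_pong x y (O : G -> Prop) :
  (exists p, O p) -> (forall p, O p -> O (x * p)) -> (forall p, O p -> O (y * p)) ->
  (forall p q, O p -> O q -> x * p <> y * q) -> free_pair x y.
Proof.
move=> [p0 Op0] Ox Oy Oxy.
have Oev w p : O p -> O (eval_pair x y w * p).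
  by move=> Op; elim: w => [|[] w IH] /=; rewrite ?mul1g // -mulgA; [apply: Ox|apply: Oy].
(* A nonempty word is not trivial: it maps the image of the other letter into its own. *)
have ne1 c w : eval_pair x y (c :: w) <> 1.
  move=> /= e; case: c e => e.
    apply: (Oxy (eval_pair x y w * (y * p0)) p0) => //; first exact/Oev/Oy.
    by rewrite mulgA e mul1g.
  apply: (Oxy p0 (eval_pair x y w * (x * p0))) => //; first exact/Oev/Ox.
  by rewrite mulgA e mul1g.
elim=> [|c w IH] [|d v] //= e.
- by have := ne1 d v; rewrite /= -e.
- by have := ne1 c w; rewrite /= e.
case: c d e => [] [] /= e.
- by rewrite (IH v) //; apply: mulgI e.
- case: (Oxy (eval_pair x y w * p0) (eval_pair x y v * p0)); do ?exact: Oev.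
  by rewrite !mulgA e.
- case: (Oxy (eval_pair x y v * p0) (eval_pair x y w * p0)); do ?exact: Oev.
  by rewrite !mulgA e.
- by rewrite (IH v) //; apply: mulgI e.
Qed.

Lemma eval_pairJ x y z w : eval_pair (x ^ z) (y ^ z) w = eval_pair x y w ^ z.
Proof. by elim: w => [|[] w /= ->]; rewrite ?conj1g ?conjMg. Qed.

Lemma free_pairJ x y z : free_pair (x ^ z) (y ^ z) -> free_pair x y.
Proof. by move=> F u v e; apply: F; rewrite !eval_pairJ e. Qed.

Lemma free_pairC x y : free_pair x y -> free_pair y x.
Proof.
move=> F; have E w : eval_pair y x w = eval_pair x y (map negb w).
  by elim: w => [|[] w /= ->].
by move=> u v; rewrite !E => /F/(inj_map negb_inj).
Qed.

Lemma free_pair_not_comm x y : free_pair x y -> x * y <> y * x.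
Proof.
move=> F e; have /F : eval_pair x y [:: true; false] = eval_pair x y [:: false; true].
  by rewrite /= !mulg1.
by [].
Qed.

Lemma free_pair_neq1 x y n : free_pair x y -> 0 < n -> x ^+ n <> 1.
Proof.
case: n => // n F _ e.
have ev k : eval_pair x y (nseq k true) = x ^+ k by elim: k => //= k ->; rewrite expgS.
by have /F : eval_pair x y (nseq n.+1 true) = eval_pair x y [::]; rewrite ?ev.
Qed.

Definition commensurable g h :=
  exists i j : nat, [/\ 0 < i, 0 < j & g ^+ i = h ^+ j \/ g ^+ i = h ^- j].

(** The sign choices are harmless for growth, since an element and its inverse have the same length. *)
Definition free_or_commensurable g h :=
  (exists g' h', [/\ g' = g \/ g' = g^-1, h' = h \/ h' = h^-1 & free_pair g' h'])
  \/ commensurable g h.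

Lemma commensurable_sym g h : commensurable g h -> commensurable h g.
Proof.
by move=> [i [j [i0 j0 [] e]]]; exists j, i; split=> //; [left|right]; rewrite e // invgK.
Qed.

Lemma commensurableVr g h : commensurable g h^-1 -> commensurable g h.
Proof.
move=> [i [j [i0 j0 e]]]; exists i, j; split=> //.
by move: e; rewrite expVgn invgK => -[] ->; [right|left].
Qed.

Lemma commensurableVl g h : commensurable g^-1 h -> commensurable g h.
Proof. by move=> /commensurable_sym/commensurableVr/commensurable_sym. Qed.

Lemma free_or_commensurableC g h :
  free_or_commensurable g h -> free_or_commensurable h g.
Proof.
case=> [[g' [h' [eg eh /free_pairC F]]]|/commensurable_sym C]; last by right.
by left; exists h', g'.
Qed.

Lemma free_or_commensurable_sym g h :
  (free_or_commensurable g h -> free_or_commensurable g h^-1) *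
  (free_or_commensurable g h -> free_or_commensurable g^-1 h).
Proof.
split=> -[[g' [h' [eg eh F]]]|C].
- by left; exists g', h'; split=> //; case: eh => ->; rewrite ?invgK; auto.
- by right; apply: commensurableVr; rewrite invgK.
- by left; exists g', h'; split=> //; case: eg => ->; rewrite ?invgK; auto.
- by right; apply: commensurableVl; rewrite invgK.
Qed.

Lemma free_or_commensurableVr g h : free_or_commensurable g h^-1 -> free_or_commensurable g h.
Proof. by rewrite -{2}[h]invgK; apply: (free_or_commensurable_sym _ _).1. Qed.
Lemma free_or_commensurableVl g h : free_or_commensurable g^-1 h -> free_or_commensurable g h.
Proof. by rewrite -{2}[g]invgK; apply: (free_or_commensurable_sym _ _).2. Qed.

Lemma free_or_commensurableJ z g h :
  free_or_commensurable (g ^ z) (h ^ z) -> free_or_commensurable g h.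
Proof.
case=> [[g' [h' [eg eh F]]]|[i [j [i0 j0 e]]]]; [left|right].
  exists (g' ^ z^-1), (h' ^ z^-1); split; last first.
    by apply: (@free_pairJ _ _ z); rewrite !conjgKV.
  by case: eh => ->; rewrite ?conjVg conjgK; auto.
  by case: eg => ->; rewrite ?conjVg conjgK; auto.
exists i, j; split=> //; move: e; rewrite -!conjXg -conjVg.
by case=> /conjg_inj; auto.
Qed.
End FreePairs.

Local Open Scope classical_set_scope.
Local Open Scope ring_scope.
(** * Limits of roots of submultiplicative sequences *)

Section Limits.
Variable R : realType.
Implicit Types (u : nat -> R) (C : R).

Lemma cvg_divn C : (fun n : nat => C * n%:R^-1 : R) @ \oo --> (0 : R).
Proof.
rewrite -[X in _ --> X](mulr0 C); apply: cvgMr.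
apply/cvgrPdist_le => e e0; exists (Num.truncn e^-1).+1 => // n /= ne.
rewrite sub0r normrN ger0_norm ?invr_ge0 ?ler0n //.
have en : e^-1 <= n%:R.
  by apply: (le_trans (ltW (truncnS_gt _))); rewrite ler_nat.
by rewrite -[e]invrK lef_pV2 // posrE ?invr_gt0 // (lt_le_trans _ en) ?invr_gt0.
Qed.

(** Writing n = q m + r with r < m gives u n <= q u m + C for a constant C that bounds the
    values u r; hence u n / n tends to the infimum of the u m / m. *)
Lemma fekete u : (forall n, 0 <= u n) -> (forall n m, u (n + m)%N <= u n + u m) ->
  cvgn (fun n => n%:R^-1 * u n).
Proof.
move=> u0 uD; pose v n : R := n%:R^-1 * u n.
pose V := [set v n | n in [set n | (0 < n)%N]]; pose L := inf V.
have v0 n : 0 <= v n by rewrite mulr_ge0 // invr_ge0.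
have Vinf : has_inf V.
  by split; [exists (v 1%N), 1%N|exists 0 => _ [n _ <-]].
have Lv n : (0 < n)%N -> L <= v n.
  by move=> n0; apply: (ge_inf Vinf.2); exists n.
suff : v @ \oo --> L by move/cvgP.
apply/cvgrPdist_le => e e0.
have [_ [m /= m0 <-] vm] := inf_adherent (divr_gt0 e0 (ltr0n _ 2)) Vinf.
pose C := \sum_(r < m) u r.
have C0 : 0 <= C by rewrite sumr_ge0.
have uC r : (r < m)%N -> u r <= C.
  by move=> rm; rewrite /C (bigD1 (Ordinal rm)) //= lerDl sumr_ge0.
have uq q r : (r < m)%N -> u (q * m + r)%N <= q%:R * u m + C.
  move=> rm; elim: q => [|q IH]; first by rewrite mul0r add0r uC.
  rewrite mulSn -addnA; apply: (le_trans (uD _ _)).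
  by rewrite -natr1 mulrDl mul1r addrAC addrC lerD2l // addrC.
have : (fun n : nat => C * n%:R^-1 : R) @ \oo --> (0 : R) by apply: cvg_divn.
move/cvgrPdist_le/(_ _ (divr_gt0 e0 (ltr0n _ 2))) => Ce.
near=> n.
have n0 : (0 < n)%N by near: n; exists 1%N.
have Cn : C * n%:R^-1 <= e / 2.
  apply: le_trans (ler_norm _) _; rewrite -normrN -sub0r; near: n; exact: Ce.
rewrite distrC ger0_norm ?subr_ge0 ?Lv //.
have m0R : 0 < m%:R :> R by rewrite ltr0n.
have n0R : 0 < n%:R :> R by rewrite ltr0n.
have : v n <= v m + C * n%:R^-1.
  have um : u m = m%:R * v m by rewrite /v mulVKf // gt_eqF.
  have := uq (n %/ m)%N (n %% m)%N (ltn_pmod _ m0); rewrite -divn_eq um => H.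
  have qm : (n %/ m)%:R * m%:R <= n%:R :> R by rewrite -natrM ler_nat leq_divM.
  rewrite {1}/v mulrC ler_pdivrMr // mulrDl divfK ?gt_eqF //.
  apply: (le_trans H); rewrite lerD2r mulrA mulrC ler_wpM2l //.
by move: Cn (vm) => /=; rewrite -/(v m) -/L; lra.
Unshelve. all: by end_near.
Qed.
End Limits.

Section GrowthRate.
Variables (R : realType) (F : nat -> nat).
Hypothesis F_gt0 : forall n, (0 < F n)%N.
Hypothesis F_mul : forall n m, (F (n + m) <= F n * F m)%N.

Let v n : R := n%:R^-1 * ln (F n)%:R.
Lemma root_expR n : (F n)%:R `^ (n%:R^-1) = expR (v n) :> R.
Proof. by rewrite /powR pnatr_eq0 gtn_eqF. Qed.

Lemma cvg_growth_log : cvgn v.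
Proof.
apply: fekete => [n|n m]; first by rewrite ln_ge0 // ler1n.
rewrite -lnM ?posrE ?ltr0n // -natrM ler_ln ?posrE ?ltr0n ?muln_gt0 ?F_gt0 //.
by rewrite ler_nat.
Qed.

Lemma lim_growthE : limn (fun n => (F n)%:R `^ (n%:R^-1) : R) = expR (limn v).
Proof.
under eq_fun do rewrite root_expR.
apply/cvg_lim => //; apply: (cvg_comp v expR cvg_growth_log).
exact: continuous_expR.
Qed.

Lemma growth_lim_ge (al C : R) : 0 < al -> 0 < C ->
  (forall n, al ^+ n <= C * (F n)%:R) -> al <= limn (fun n => (F n)%:R `^ (n%:R^-1) : R).
Proof.
move=> al0 C0 H; rewrite lim_growthE -[al]lnK ?posrE // ler_expR.
have w : (fun n : nat => ln al - ln C * n%:R^-1 : R) @ \oo --> ln al - 0.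
  by apply: cvgB; [exact: cvg_cst|exact: cvg_divn].
rewrite subr0 in w; rewrite -(cvg_lim _ w) //.
apply: ler_lim; [exact: cvgP w|exact: cvg_growth_log|].
near=> n; have n0 : 0 < n%:R :> R by rewrite ltr0n; near: n; exists 1%N.
rewrite /v lerBlDr mulrC -mulrDl ler_pdivlMr // addrC.
rewrite -lnM ?posrE ?ltr0n // (mulr_natr (ln al)) -lnXn // ler_ln ?posrE ?exprn_gt0 ?mulr_gt0 ?ltr0n //.
Unshelve. all: by end_near.
Qed.

Lemma growth_lim_le (al C : R) : 0 < al -> 0 < C ->
  (forall n, (F n)%:R <= C * al ^+ n) -> limn (fun n => (F n)%:R `^ (n%:R^-1) : R) <= al.
Proof.
move=> al0 C0 H; rewrite lim_growthE -[X in _ <= X]lnK ?posrE // ler_expR.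
have w : (fun n : nat => ln al + ln C * n%:R^-1 : R) @ \oo --> ln al + 0.
  by apply: cvgD; [exact: cvg_cst|exact: cvg_divn].
rewrite addr0 in w; rewrite -(cvg_lim _ w) //.
apply: ler_lim; [exact: cvg_growth_log|exact: cvgP w|].
near=> n; have n0 : 0 < n%:R :> R by rewrite ltr0n; near: n; exists 1%N.
rewrite /v -[X in X + _](mulfK (lt0r_neq0 n0)) -mulrDl mulrC ler_pM2r ?invr_gt0 //.
rewrite (mulr_natr (ln al)) -lnXn // addrC -lnM ?posrE ?exprn_gt0 //.
by rewrite ler_ln ?posrE ?ltr0n ?mulr_gt0 ?exprn_gt0.
Unshelve. all: by end_near.
Qed.
End GrowthRate.

(** Both limits exist by Fekete's lemma, so the comparison passes to the limit. *)
Lemma growth_lim_mono (R : realType) (F1 F2 : nat -> nat) :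
  (forall n, (0 < F1 n)%N) -> (forall n m, (F1 (n + m) <= F1 n * F1 m)%N) ->
  (forall n, (0 < F2 n)%N) -> (forall n m, (F2 (n + m) <= F2 n * F2 m)%N) ->
  (forall n, (F1 n <= F2 n)%N) ->
  limn (fun n => (F1 n)%:R `^ (n%:R^-1) : R) <= limn (fun n => (F2 n)%:R `^ (n%:R^-1) : R).
Proof.
move=> F1_gt0 F1_mul F2_gt0 F2_mul F12.
rewrite !lim_growthE // ler_expR; apply: ler_lim; [exact: cvg_growth_log..|].
apply: nearW => n; rewrite ler_wpM2l // ?invr_ge0 // ler_ln ?posrE ?ltr0n //.
by rewrite ler_nat.
Qed.

(** * Word balls *)

Section Balls.
Variables (G : groupType) (S : set G).
Implicit Types (g x y : G) (n m : nat).

Lemma is_product1 : is_product S 1%g 0.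
Proof. by exists [::]; split=> //; rewrite big_nil. Qed.

Lemma is_productM n m x y : is_product S x n -> is_product S y m ->
  is_product S (x * y)%g (n + m)%N.
Proof.
move=> [w [<- lw <-]] [v [<- lv <-]]; exists (w ++ v); split.
- by rewrite size_cat.
- by move=> z; rewrite mem_cat => /orP[/lw|/lv].
- by rewrite big_cat.
Qed.

Lemma letters_inv x : letters S x -> letters S x^-1%g.
Proof. by case=> [Sx|[y Sy <-]]; [right; exists x|left; rewrite invgK]. Qed.

Lemma is_product_letter x : letters S x -> is_product S x 1.
Proof.
by move=> Lx; exists [:: x]; split=> // [y|]; rewrite ?big_seq1 // inE => /eqP ->.
Qed.

Lemma is_productV n x : is_product S x n -> is_product S x^-1%g n.
Proof.
move=> [w [sw lw <-]]; elim: w n sw lw => [|y w IH] n <- lw.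
  by rewrite big_nil invg1; apply: is_product1.
rewrite big_cons invgM /= -addn1; apply: is_productM.
  by apply: IH => // z zw; apply: lw; rewrite inE zw orbT.
by apply/is_product_letter/letters_inv/lw/mem_head.
Qed.

Lemma is_product_split n m x : is_product S x (n + m)%N ->
  exists y z, [/\ is_product S y n, is_product S z m & x = (y * z)%g].
Proof.
move=> [w [sw lw <-]]; exists (\big[*%g/1%g]_(i <- take n w) i), (\big[*%g/1%g]_(i <- drop n w) i).
split; last by rewrite -big_cat cat_take_drop.
- exists (take n w); split=> //; first by rewrite size_takel // sw leq_addr.
  by move=> z /mem_take/lw.
- exists (drop n w); split=> //; first by rewrite size_drop sw addKn.
  by move=> z /mem_drop/lw.
Qed.

Lemma is_product0 x : is_product S x 0 -> x = 1%g.
Proof. by move=> [w [/size0nil -> _ <-]]; rewrite big_nil. Qed.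

Lemma is_product1P x : is_product S x 1 -> letters S x.
Proof. by move=> [[|y [|z w]] [] // _ lw <-]; rewrite big_seq1; apply/lw/mem_head. Qed.

Hypothesis S_gen : generates S.

Lemma word_ballP n g : word_ball S n g <-> exists2 k, (k <= n)%N & is_product S g k.
Proof.
rewrite /word_ball /= /word_length; case: pselect => [p|np]; last first.
  by case: np; have [k Pk] := S_gen g; exists k; apply/asboolP.
case: ex_minnP => k /asboolP Pk mink; split; first by exists k.
by move=> [l ln /asboolP Pl]; apply: leq_trans (mink _ Pl) ln.
Qed.

Lemma word_ball1 n : word_ball S n 1%g.
Proof. by apply/word_ballP; exists 0%N => //; apply: is_product1. Qed.

Lemma word_ball_gen x : S x -> word_ball S 1 x.
Proof. by move=> Sx; apply/word_ballP; exists 1%N => //; apply/is_product_letter; left. Qed.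

Lemma word_ballM n m x y : word_ball S n x -> word_ball S m y -> word_ball S (n + m) (x * y)%g.
Proof.
move=> /word_ballP[k kn Pk] /word_ballP[l lm Pl]; apply/word_ballP; exists (k + l)%N.
  exact: leq_add.
exact: is_productM.
Qed.

Lemma word_ballV n x : word_ball S n x -> word_ball S n x^-1%g.
Proof.
by move=> /word_ballP[k kn Pk]; apply/word_ballP; exists k => //; apply: is_productV.
Qed.

Lemma word_ballW n m x : (n <= m)%N -> word_ball S n x -> word_ball S m x.
Proof. by move=> nm xn; apply: leq_trans nm. Qed.

Lemma word_ball_split n m x : word_ball S (n + m) x ->
  exists y z, [/\ word_ball S n y, word_ball S m z & x = (y * z)%g].
Proof.
move=> /word_ballP[k knm]; have [kn|nk] := leqP k n => Pk.
  by exists x, 1%g; split; rewrite ?mulg1 //; [apply/word_ballP; exists k|apply: word_ball1].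
have := Pk; rewrite -(subnKC (ltnW nk)) => /is_product_split[y [z [Py Pz ->]]].
exists y, z; split=> //; first by apply/word_ballP; exists n.
by apply/word_ballP; exists (k - n)%N => //; lia.
Qed.

Lemma generates_ind (P : G -> Prop) : P 1%g -> (forall x y, P x -> P y -> P (x * y)%g) ->
  (forall x, P x -> P x^-1%g) -> (forall x, S x -> P x) -> forall g, P g.
Proof.
move=> P1 PM PV PS g; have [n [w [_ lw <-]]] := S_gen g.
elim: w lw => [|x w IH] lw; rewrite ?big_nil // big_cons; apply: PM.
  by case: (lw x (mem_head _ _)) => [/PS //|[y /PS Py <-]]; apply: PV.
by apply: IH => z zw; apply: lw; rewrite inE zw orbT.
Qed.

Hypothesis S_fin : finite_set S.

Lemma finite_word_ball n : finite_set (word_ball S n).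
Proof.
have fin1 : finite_set (word_ball S 1).
  apply: (@sub_finite_set _ _ (1%g |` letters S)).
    move=> x /word_ballP[[|[|//]]] _; first by move/is_product0; left.
    by move/is_product1P; right.
  by rewrite !finite_setU; split=> //; split=> //; apply: finite_image.
elim: n => [|n IH].
  by apply: sub_finite_set fin1 => x; apply: word_ballW.
apply: (@sub_finite_set _ _ [set (p.1 * p.2)%g | p in word_ball S n `*` word_ball S 1]).
  move=> x; rewrite -addn1 => /word_ball_split[y [z [By Bz ->]]].
  by exists (y, z).
exact/finite_image/finite_setX.
Qed.

Lemma growth_ge n (s : seq G) : uniq s -> (forall x, x \in s -> word_ball S n x) ->
  (size s <= growth S n)%N.
Proof.
move=> us sB; rewrite /growth; apply: uniq_leq_size => // x /sB Bx.
by rewrite in_fset_set ?inE //; exact: finite_word_ball.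
Qed.

Lemma growth_le n (s : seq G) : (forall x, word_ball S n x -> x \in s) ->
  (growth S n <= size s)%N.
Proof.
move=> Bs; rewrite /growth; apply: uniq_leq_size; first exact: fset_uniq.
by move=> x; rewrite in_fset_set ?inE //; [move/Bs|exact: finite_word_ball].
Qed.

Lemma growth_gt0 n : (0 < growth S n)%N.
Proof. by apply: (@growth_ge n [:: 1%g]) => // x; rewrite inE => /eqP ->; apply: word_ball1. Qed.

Lemma growth_submul n m : (growth S (n + m) <= growth S n * growth S m)%N.
Proof.
pose s k : seq G := enum_fset (fset_set (word_ball S k)).
have sP k x : word_ball S k x -> x \in s k.
  by move=> Bx; rewrite in_fset_set ?inE //; exact: finite_word_ball.
rewrite -(size_allpairs (fun x y => x * y)%g (s n) (s m)).
apply: growth_le => x /word_ball_split[y [z [By Bz ->]]].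
by apply: allpairs_f; apply: sP.
Qed.
End Balls.

(** * Growth in a quotient *)

Section Surjections.
Variables (G H : groupType) (f : G -> H) (S : set G).
Hypothesis fM : {morph f : x y / (x * y)%g >-> (x * y)%g}.
Hypothesis f_surj : forall y, exists x, f x = y.
Hypotheses (S_gen : generates S) (S_fin : finite_set S).

Let f1 : f 1%g = 1%g. Proof. by apply: (@mulgI _ (f 1%g)); rewrite -fM !mulg1. Qed.
Let fV x : f x^-1%g = (f x)^-1%g. Proof. by apply/esym/mulg1_eq; rewrite -fM mulgV. Qed.

Lemma image_generates : generates [set f x | x in S].
Proof.
move=> y; have [x <-] := f_surj y.
apply: (generates_ind S_gen (P := fun x => exists n, is_product [set f x | x in S] (f x) n)).
- by exists 0%N; rewrite f1; apply: is_product1.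
- by move=> u v [n Pu] [m Pv]; exists (n + m)%N; rewrite fM; apply: is_productM.
- by move=> u [n Pu]; exists n; rewrite fV; apply: is_productV.
- by move=> u Su; exists 1%N; apply: is_product_letter; left; exists u.
Qed.

(** Letter by letter, a word over the image of S is the image of a word over S. *)
Lemma word_ball_image_lift n y : word_ball [set f x | x in S] n y ->
  exists2 x, word_ball S n x & f x = y.
Proof.
elim: n y => [|n IH] y.
  move=> /(word_ballP image_generates)[[|//] _ /is_product0 ->].
  by exists 1%g; [apply: word_ball1|].
rewrite -addn1 => /(word_ball_split image_generates)[u [v [/IH[x Bx <-] Bv ->]]].
suff [z Bz <-] : exists2 z, word_ball S 1 z & f z = v.
  by exists (x * z)%g; [apply: word_ballM|rewrite fM].
move: Bv => /(word_ballP image_generates)[[|[|//]] _].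
  by move=> /is_product0 ->; exists 1%g => //; apply: word_ball1.
case/is_product1P => [[z Sz <-]|[_ [z Sz <-] <-]].
  by exists z => //; apply: word_ball_gen.
by exists z^-1%g; [apply/word_ballV/word_ball_gen|].
Qed.

Lemma growth_image_le n : (growth [set f x | x in S] n <= growth S n)%N.
Proof.
pose s : seq G := enum_fset (fset_set (word_ball S n)).
rewrite -[growth S n](size_map f s).
apply: growth_le => [||y]; [exact: image_generates|exact: finite_image|].
move=> /word_ball_image_lift[x Bx <-]; apply: map_f; rewrite in_fset_set ?inE //.
exact: finite_word_ball.
Qed.

Lemma growth_rate_image_le (R : realType) :
  growth_rate R [set f x | x in S] <= growth_rate R S.
Proof.
have fS := finite_image f S_fin; have gS := image_generates.
apply: growth_lim_mono; [exact: growth_gt0|exact: growth_submul|exact: growth_gt0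
  |exact: growth_submul|exact: growth_image_le].
Qed.
End Surjections.

Local Close Scope ring_scope.
Local Close Scope classical_set_scope.

(** * Half-trees of the trivalent tree *)

Section HalfTrees.
Local Open Scope group_scope.
(** An element u of G stands for the half-tree u T, where T is a fixed half-tree.
    The element a exchanges T with its complement, b preserves T and exchanges its
    two children, and the children of T are sh true T and sh false T.  Thus u and
    u b give the same half-tree, and u a is the complement of u.  In PGL(2,Z), T
    is the positive quadrant, a is diag(-1,1), b is the transposition of the
    coordinates, and sh true, sh false are the two elementary shears.  The set N
    consists of the n with n T contained in T. *)
Variables (G : groupType) (a b : G) (sh : bool -> G).
Implicit Types (g h x y u v n m : G) (w p q : seq bool) (c d e f : bool).

Definition word_prod w : G := foldr (fun c x => sh c * x) 1 w.
Definition nf w e : G := word_prod w * b ^+ e.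
Definition N g := exists w e, g = nf w e.
(** The n for which n T is strictly contained in T. *)
Definition Npos g := exists c w e, g = nf (c :: w) e.

Hypothesis aa : a * a = 1.
Hypothesis bb : b * b = 1.
Hypothesis ab : a * b = b * a.
(** The first of these identities says that b exchanges the two children; the
    other two make b a (sh true) a rotation of order 3 about a vertex ([rho3]). *)
Hypothesis b_sh : forall c, b * sh c = sh (~~ c) * b.
Hypothesis sh_a_same : forall c, sh c * a * sh c = a.
Hypothesis sh_a_diff : forall c, sh c * a * sh (~~ c) = sh (~~ c) * b.
(** The children of T are disjoint, T is disjoint from its complement, and any
    half-tree is nested with T after a choice of orientations. *)
Hypothesis children_disjoint : forall n m, N n -> N m -> sh true * n <> sh false * m.
Hypothesis complement_disjoint : forall n m, N n -> N m -> n <> a * m.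
Hypothesis orientation_cover : forall g, exists i j : bool, N (a ^+ i * g * a ^+ j).

Lemma aV : a^-1 = a. Proof. exact: (mulg1_eq aa). Qed.
Lemma bV : b^-1 = b. Proof. exact: (mulg1_eq bb). Qed.
Lemma mulaK g : a * (a * g) = g. Proof. by rewrite mulgA aa mul1g. Qed.
Lemma mulKa g : g * a * a = g. Proof. by rewrite -mulgA aa mulg1. Qed.
Lemma mulKb g : g * b * b = g. Proof. by rewrite -mulgA bb mulg1. Qed.

Lemma word_prod_cat w (v : seq bool) : word_prod (w ++ v) = word_prod w * word_prod v.
Proof. by elim: w => [|c w IH] /=; rewrite ?mul1g // IH mulgA. Qed.

Lemma b_word_prod e w : b ^+ e * word_prod w = word_prod (map (addb e) w) * b ^+ e.
Proof.
case: e; last by rewrite !expg0 mulg1 mul1g; congr word_prod; rewrite -[LHS]map_id; apply: eq_map => -[].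
elim: w => [|c w IH] /=; first by rewrite mulg1 mul1g.
by rewrite mulgA b_sh -mulgA IH mulgA.
Qed.

Lemma expb_add e f : b ^+ e * b ^+ f = b ^+ (e (+) f).
Proof. by case: e f => [] [] //=; rewrite ?expg1 ?expg0 ?mulg1 ?mul1g. Qed.

Lemma nfM w e (v : seq bool) f : nf w e * nf v f = nf (w ++ map (addb e) v) (e (+) f).
Proof. by rewrite /nf word_prod_cat -!mulgA; congr (_ * _); rewrite mulgA b_word_prod -!mulgA expb_add. Qed.

Lemma N_nf w e : N (nf w e). Proof. by exists w, e. Qed.
Lemma nf1 : nf [::] false = 1. Proof. exact: mul1g. Qed.
Lemma nfb : nf [::] true = b. Proof. exact: mul1g. Qed.
Lemma nf_cons c w e : nf (c :: w) e = sh c * nf w e. Proof. by rewrite /nf /= -mulgA. Qed.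
Lemma N1 : N 1. Proof. by rewrite -nf1; apply: N_nf. Qed.
Lemma Nb : N b. Proof. by rewrite -nfb; apply: N_nf. Qed.
Lemma NM n m : N n -> N m -> N (n * m).
Proof. by move=> [w [e ->]] [v [f ->]]; rewrite nfM; apply: N_nf. Qed.
Lemma Nsh c : N (sh c).
Proof. by exists [:: c], false; rewrite nf_cons nf1 mulg1. Qed.
Lemma Npos_N n : Npos n -> N n.
Proof. by move=> [c [w [e ->]]]; apply: N_nf. Qed.

Lemma N_cases n : N n -> [\/ n = 1, n = b | Npos n].
Proof.
move=> [[|c w] [e ->]]; last by apply: Or33; exists c, w, e.
by case: e; [apply: Or32|apply: Or31]; rewrite ?nf1 ?nfb.
Qed.
Lemma NposP n : Npos n <-> exists c m, N m /\ n = sh c * m.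
Proof.
split=> [[c [w [e ->]]]|[c [m [[w [e ->]] ->]]]].
  by exists c, (nf w e); split; [apply: N_nf|rewrite nf_cons].
by exists c, w, e; rewrite nf_cons.
Qed.
Lemma NposM n m : Npos n -> N m -> Npos (n * m).
Proof. by move=> [c [w [e ->]]] [v [f ->]]; rewrite nfM /=; do 3!eexists. Qed.
Lemma NMpos n m : N n -> Npos m -> Npos (n * m).
Proof.
move=> [[|c w] [e ->]] [d [v [f ->]]]; rewrite nfM /=; do 3!eexists; reflexivity.
Qed.
(** If 1 lay in sh c N, so would every element of N, in particular an element of the other
    child. *)
Lemma Npos_not1 : ~ Npos 1.
Proof.
move=> /NposP[c [m [Nm e]]].
have Nx : N (m * sh (~~ c)) by apply: NM => //; apply: Nsh.
have E : sh (~~ c) * 1 = sh c * (m * sh (~~ c)) by rewrite mulgA -e mulg1 mul1g.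
by case: c {e} E Nx => /= E Nx; [apply: (children_disjoint Nx N1)|apply: (children_disjoint N1 Nx)].
Qed.
Lemma Npos_notb : ~ Npos b.
Proof. by move=> Pb; apply: Npos_not1; rewrite -bb; apply: NposM Pb Nb. Qed.
Lemma Npos_exp n k : Npos n -> 0 < k -> Npos (n ^+ k).
Proof.
move=> Pn; elim: k => // -[|k] IH _; first by rewrite expg1.
by rewrite expgS; apply: NposM => //; apply/Npos_N/IH.
Qed.

(** The children are disjoint, so the letters of a word are read off one at a time; the sign e
    survives because b is not 1, its conjugation exchanging sh true and sh false. *)
Lemma nf_inj w e (v : seq bool) f : nf w e = nf v f -> w = v /\ e = f.
Proof.
have one d (u : seq bool) e' e2 : nf (d :: u) e' <> nf [::] e2.
  move=> E; have : Npos (nf [::] e2) by rewrite -E; do 3!eexists.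
  by case: (e2); rewrite ?nf1 ?nfb; [exact: Npos_notb|exact: Npos_not1].
elim: w v => [|c w IH] [|d v] E.
- split=> //; case: e f E => [] [] //=; rewrite nf1 nfb => E.
    case: (@children_disjoint b b Nb Nb); rewrite E !mulg1.
    by have := b_sh true; rewrite E mulg1 mul1g.
  case: (@children_disjoint b b Nb Nb); rewrite -E !mulg1.
  by have := b_sh true; rewrite -E mulg1 mul1g.
- by case: (one _ _ _ _ (esym E)).
- by case: (one _ _ _ _ E).
move: E; rewrite !nf_cons.
case: c d => [] [] E.
- by have [-> ->] := IH _ (mulgI _ _ _ E).
- by case: (children_disjoint (N_nf w e) (N_nf v f)).
- by case: (children_disjoint (N_nf v f) (N_nf w e)).
- by have [-> ->] := IH _ (mulgI _ _ _ E).
Qed.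

(** * The order on half-trees *)

(** The half-tree u is contained in the half-tree v when v^-1 u maps T into itself. *)
Definition hle u v := N (v^-1 * u).
Definition hlt u v := Npos (v^-1 * u).

Lemma hle_refl u : hle u u. Proof. by rewrite /hle mulVg; apply: N1. Qed.
Lemma hle_trans u v x : hle u v -> hle v x -> hle u x.
Proof. by rewrite /hle => A B; have := NM B A; gsimp. Qed.
Lemma hltW u v : hlt u v -> hle u v. Proof. exact: Npos_N. Qed.
Lemma hlt_le_trans u v x : hlt u v -> hle v x -> hlt u x.
Proof. by rewrite /hle /hlt => A B; have := NMpos B A; gsimp. Qed.
Lemma hle_hlt_trans u v x : hle u v -> hlt v x -> hlt u x.
Proof. by rewrite /hle /hlt => A B; have := NposM B A; gsimp. Qed.
Lemma hlt_not_le u v : hlt u v -> ~ hle v u.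
Proof. by move=> A /(hlt_le_trans A); rewrite /hlt mulVg => /Npos_not1. Qed.
Lemma hle_mul g u v : hle (g * u) (g * v) <-> hle u v.
Proof. by rewrite /hle; gsimp. Qed.
Lemma hlt_mul g u v : hlt (g * u) (g * v) <-> hlt u v.
Proof. by rewrite /hlt; gsimp. Qed.
Lemma hlt_conj g u : hlt (g * u) u <-> Npos (g ^ u).
Proof. by rewrite /hlt conjgE. Qed.
Lemma hle_hlt u v : hle u v -> hlt u v \/ v^-1 * u = 1 \/ v^-1 * u = b.
Proof. by case/N_cases; rewrite /hlt; auto. Qed.

Lemma star_sh c : a * (sh c)^-1 * a = sh c.
Proof.
apply: (mulIg (a * (sh c))); rewrite mulgA mulKa mulgVK.
by rewrite mulgA sh_a_same.
Qed.
(** The map n -> a n^-1 a sends an inclusion to the inclusion of the complements; it fixes the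
    letters and reverses words, so it preserves their length. *)
Lemma star_nf w e : exists v : seq bool, size v = size w /\ a * (nf w e)^-1 * a = nf v e.
Proof.
suff [v [sv E]] : exists v : seq bool, size v = size w /\ a * (word_prod w)^-1 * a = word_prod v.
  have ba : a * (b ^+ e)^-1 = b ^+ e * a by case: e; rewrite ?expg1 ?expg0 ?invg1 ?mulg1 ?mul1g // bV ab.
  exists (map (addb e) v); split; first by rewrite size_map.
  by rewrite /nf -b_word_prod -E invgM !mulgA ba.
elim: w => [|c w [v [sv E]]]; first by exists [::]; rewrite /= invg1 mulg1 aa.
exists (rcons v c); split; first by rewrite size_rcons sv.
rewrite /= invgM -cats1 word_prod_cat -E /= mulg1 -[in RHS](star_sh c).
by gsimp; rewrite mulKa.
Qed.
Lemma star_N n : N n -> N (a * n^-1 * a).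
Proof. by move=> [w [e ->]]; have [v [_ ->]] := star_nf w e; apply: N_nf. Qed.
Lemma hle_star u v : hle u v -> hle (v * a) (u * a).
Proof. by rewrite /hle => /star_N; gsimp; rewrite aV. Qed.
Lemma hle_starE u v : hle (v * a) (u * a) <-> hle u v.
Proof. by split=> [/hle_star|/hle_star //]; rewrite !mulKa. Qed.
Lemma hlt_starE u v : hlt (v * a) (u * a) <-> hlt u v.
Proof.
suff H x y : hlt x y -> hlt (y * a) (x * a) by split=> /H //; rewrite !mulKa.
move=> L; case: (hle_hlt (hle_star (hltW L))) => // E.
case: (hlt_not_le L); apply/hle_starE; rewrite /hle.
have {}E : (y * a)^-1 * (x * a) = 1 \/ (y * a)^-1 * (x * a) = b.
  by case: E => E; [left|right]; rewrite -[LHS]invgK invgM invgK E ?invg1 ?bV.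
by case: E => ->; [apply: N1|apply: Nb].
Qed.
Lemma hle_starr u v : hle u (v * a) -> hle v (u * a).
Proof. by move/hle_star; rewrite mulKa. Qed.
Lemma hle_disj u v : hle u v -> ~ hle u (v * a).
Proof.
move=> A B; apply: (complement_disjoint A B).
by rewrite invgM aV !mulgA aa mul1g.
Qed.
Lemma hle_total4 u v : [\/ hle u v, hle u (v * a), hle (u * a) v | hle v u].
Proof.
have [i [j H]] := orientation_cover (v^-1 * u).
case: i j H => [] []; rewrite ?expg1 ?expg0 ?mul1g ?mulg1 => H.
- by apply: Or44; apply/hle_starE; rewrite /hle invgM aV -mulgA -mulgA ?mulgA in H *.
- by apply: Or42; rewrite /hle invgM aV -mulgA.
- by apply: Or43; rewrite /hle mulgA.
- exact: Or41.
Qed.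

(** * Ping-pong for two translations *)

Lemma first_difference (p q : seq bool) : size p = size q -> p <> q ->
  exists w c p' q', p = w ++ c :: p' /\ q = w ++ ~~ c :: q'.
Proof.
elim: p q => [|c p IH] [|d q] //= [s] ne.
have [e|ncd] := eqVneq c d.
  have [|w [c' [p' [q' [-> ->]]]]] := IH q s; first by move=> e'; apply: ne; rewrite e e'.
  by exists (c :: w), c', p', q'; rewrite e.
exists [::], c, p, q; split=> //=; congr (_ :: _).
by case: c d ncd {ne} => [] [].
Qed.

(** Moving b^e to the right through a word applies the letter exchange; an even power cancels
    the signs and is a plain word. *)
Lemma even_power_unsigned w e k :
  exists p, size p = (k * (2 * size w))%N /\ nf w e ^+ (2 * k)%N = word_prod p.
Proof.
have E2 : nf w e ^+ 2 = word_prod (w ++ map (addb e) w).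
  by rewrite expg2 nfM addbb /nf expg0 mulg1.
elim: k => [|k [p [sp E]]]; first by exists [::].
exists ((w ++ map (addb e) w) ++ p); split.
  by rewrite !size_cat size_map sp; lia.
by rewrite word_prod_cat -E -E2 -expgnDr; congr (_ ^+ _); lia.
Qed.

(** If p c begins a power of g = nf w e, then g p begins with p c: both are prefixes of the word
    of g g^k = g^k g, and g p is longer than p. *)
Lemma prefix_attracts w e p c p' k :
  0 < size w -> nf w e ^+ k = word_prod (p ++ c :: p') -> N ((word_prod (rcons p c))^-1 * (nf w e * word_prod p)).
Proof.
move=> w0 E.
have := commuteX k (commute_refl (nf w e)); rewrite /commute E -[word_prod _]mulg1 -[1](expg0 b).
rewrite -/(nf _ false) !nfM addbF addFb => /nf_inj[E' _].
rewrite -[word_prod p]mulg1 -[1](expg0 b) -/(nf p false) nfM addbF.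
have -> : w ++ map (addb e) p = rcons p c ++ drop (size p).+1 (w ++ map (addb e) p).
  rewrite -{1}(cat_take_drop (size p).+1 (w ++ map (addb e) p)); congr (_ ++ _).
  move: (congr1 (take (size p).+1) E'); rewrite map_cat catA take_cat.
  rewrite size_cat size_map.
  have -> : (size p).+1 < (size w + size p)%N = (1 < size w) by lia.
  have T : take (size p).+1 ((p ++ c :: p') ++ map (addb false) w) = rcons p c.
    by rewrite -cat_rcons -catA take_size_cat // size_rcons.
  case: ltnP => lw; first by rewrite T.
  have sw : size w = 1%N by lia.
  rewrite (_ : ((size p).+1 - _)%N = 0) ?take0 ?cats0; last by lia.
  by rewrite T => ->; rewrite take_oversize // size_rcons.
rewrite /nf word_prod_cat; gsimp.
exact: N_nf.
Qed.

(** Ping-pong on the half-tree below w, when g and h push it into different children. *)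
Lemma free_pair_of_branch w g h : 
  (exists c, hle (g * word_prod w) (word_prod (rcons w c)) /\ hle (h * word_prod w) (word_prod (rcons w (~~ c)))) ->
  free_pair g h.
Proof.
move=> [c [Lg Lh]].
have rc d : word_prod (rcons w d) = word_prod w * sh d by rewrite -cats1 word_prod_cat /= mulg1.
have Ld d : hle (word_prod (rcons w d)) (word_prod w) by rewrite rc /hle; gsimp; apply: Nsh.
apply: (@free_pair_ping_pong _ g h (fun x => hle x (word_prod w))).
- by exists (word_prod w); apply: hle_refl.
- by move=> p Op; apply: hle_trans (Ld c); apply: hle_trans Lg; apply/hle_mul.
- by move=> p Op; apply: hle_trans (Ld (~~ c)); apply: hle_trans Lh; apply/hle_mul.
move=> p q Op Oq E.
have A : hle (g * p) (word_prod (rcons w c)) by apply: hle_trans Lg; apply/hle_mul.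
have B : hle (g * p) (word_prod (rcons w (~~ c))) by rewrite E; apply: hle_trans Lh; apply/hle_mul.
move: A B; rewrite /hle !rc !invgM -!mulgA; set z := _ * (g * p) => A B.
have E1 d : z = sh d * ((sh d)^-1 * z) by rewrite mulgA mulgV mul1g.
by case: c {Lg Lh} A B => /= A B; [apply: (children_disjoint A B)|apply: (children_disjoint B A)]; rewrite -!E1.
Qed.

(** Compare the powers of g and h of the same length: equal words give a common power, and
    otherwise the first difference is a vertex where the two axes separate. *)
Lemma coherent_pair g h : Npos g -> Npos h -> free_pair g h \/ commensurable g h.
Proof.
move=> [c [u [e ->]]] [d [v [f ->]]]; set U := c :: u; set V := d :: v.
(* These even powers of g and h are unsigned words of the same length 2 |U| |V|. *)
have [p [sp Ep]] := even_power_unsigned U e (size V).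
have [q [sq Eq]] := even_power_unsigned V f (size U).
have [epq|npq] := eqVneq p q.
  right; exists (2 * size V)%N, (2 * size U)%N; split=> //; left.
  by rewrite Ep Eq epq.
left; have [|w [x [p' [q' [ep eq]]]]] := first_difference _ (elimN eqP npq).
  by rewrite sp sq; lia.
apply: (@free_pair_of_branch w); exists x; split.
  by apply: (@prefix_attracts _ _ _ _ p' (2 * size V)%N); rewrite // -ep.
by apply: (@prefix_attracts _ _ _ _ q' (2 * size U)%N); rewrite // -eq.
Qed.

(** Translations of axes that share an edge with the same direction, moved to the base edge. *)
Lemma shared_edge_pair g h H : hlt (g * H) H -> hlt (h * H) H ->
  free_or_commensurable g h.
Proof.
move=> /hlt_conj Pg /hlt_conj Ph; apply: (@free_or_commensurableJ _ H).
case: (coherent_pair Pg Ph); [left|by right].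
by exists (g ^ H), (h ^ H); split; auto.
Qed.

Definition N_size n k := exists w e, size w = k /\ n = nf w e.

Lemma hltV g H : hlt (g * H) H <-> hlt (g^-1 * (H * a)) (H * a).
Proof.
by rewrite mulgA hlt_starE -(hlt_mul g (H)) mulgA mulgV mul1g.
Qed.

Lemma hltX g H k : hlt (g * H) H -> 0 < k -> hlt (g ^+ k * H) H.
Proof. by move=> /hlt_conj P k0; apply/hlt_conj; rewrite conjXg; apply: Npos_exp. Qed.

(** Here H and K are disjoint half-trees on the axes of g and h, and k is the distance between
    their edges.  If g^-1 H is still disjoint from K, it is closer to K; if it contains the
    complement of K, both axes pass through the edge of K; otherwise g K is contained in H.
    When also h H is contained in K, the union of H and K is a ping-pong domain. *)
Lemma facing_pair k g h H K :
  N_size ((K * a)^-1 * H) k ->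
  hlt (g * H) H -> hlt (h * K) K -> free_or_commensurable g h.
Proof.
elim/ltn_ind: k g h H K => k IH.
have step g h H K : N_size ((K * a)^-1 * H) k -> hlt (g * H) H -> hlt (h * K) K ->
    free_or_commensurable g h \/ hle (g * K) H.
  move=> NHK Hg HK.
  have HKs : hle H (K * a) by case: NHK => w [e [_]]; rewrite /hle => ->; apply: N_nf.
  have Hg' : hlt H (g^-1 * H) by rewrite -(hlt_mul g) mulgA mulgV mul1g.
  case: (hle_total4 K (g^-1 * H)) => L.
  - by right; rewrite -(hle_mul g^-1) mulKg.
  (* The half-tree g^-1 H is disjoint from K and strictly larger than H. *)
  - left; have F : hle (g^-1 * H) (K * a) by apply: hle_starr.
    case: F => w [e F]; case: NHK => v [f [sv E]].
    have [c [u [e' E']]] := Hg'.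
    have := E; rewrite -[H](mulVKg (g^-1 * H)) E' mulgA F nfM => /nf_inj[/(congr1 size)].
    rewrite size_cat size_map /= sv => sk _.
    apply: (IH (size w) _ g h (g^-1 * H) K) => //; first by lia.
      by exists w, e.
    by rewrite mulgA mulgV mul1g.
  (* The edge of K lies on both axes, which it crosses in opposite directions. *)
  - left; apply: free_or_commensurableVr.
    have gK : hle (g * (K * a)) H.
      by rewrite -(hle_mul g^-1) mulKg.
    apply: (@shared_edge_pair _ _ (K * a)); last exact: (hltV h K).1 HK.
    case: (hle_hlt HKs) => [HKs'|E]; first exact: hle_hlt_trans gK HKs'.
    have KH : hle (K * a) H.
      by rewrite /hle -[_^-1 * _]invgK invgM invgK; case: E => ->; rewrite ?invg1 ?bV; [apply: N1|apply: Nb].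
    apply: hlt_le_trans HKs; apply: hle_hlt_trans Hg.
    exact/hle_mul.
  - by case: (hle_disj (hle_trans (hltW Hg') L) HKs).
move=> g h H K NHK Hg HK.
case: (step g h H K) => // LgK.
have NKH : N_size ((H * a)^-1 * K) k.
  case: NHK => w [e [sw E]]; have [v [sv E']] := star_nf w e.
  exists v, e; rewrite sv -E'; split=> //; rewrite -E; gsimp.
  by rewrite aV mulKa.
case: (step h g K H) => // [/free_or_commensurableC //|LhH].
have HK0 : hle H (K * a) by case: NHK => w [e [_]]; rewrite /hle => ->; apply: N_nf.
left; exists g, h; split; auto.
apply: (@free_pair_ping_pong _ g h (fun x => hle x H \/ hle x K)).
- by exists H; left; apply: hle_refl.
- move=> p [] Op; left; first by apply: hle_trans (hltW Hg); apply/hle_mul.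
  by apply: hle_trans LgK; apply/hle_mul.
- move=> p [] Op; right; last by apply: hle_trans (hltW HK); apply/hle_mul.
  by apply: hle_trans LhH; apply/hle_mul.
move=> p q Op Oq E.
have A : hle (g * p) H.
  by case: Op => Op; [apply: hle_trans (hltW Hg)|apply: hle_trans LgK]; apply/hle_mul.
have B : hle (g * p) K.
  by rewrite E; case: Oq => Oq; [apply: hle_trans LhH|apply: hle_trans (hltW HK)]; apply/hle_mul.
exact: hle_disj B (hle_trans A HK0).
Qed.

(** Inverting g or h replaces H or K by its complement, so the two half-trees may be assumed
    disjoint. *)
Lemma hyperbolic_pair g h H K : hlt (g * H) H -> hlt (h * K) K ->
  free_or_commensurable g h.
Proof.
move=> Hg HK.
have F g' h' H' K' : hle H' (K' * a) -> hlt (g' * H') H' -> hlt (h' * K') K' ->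
    free_or_commensurable g' h'.
  by move=> [w [e E]]; apply: (@facing_pair (size w)); exists w, e.
have Vg : hlt (g^-1 * (H * a)) (H * a) by exact: (hltV g H).1 Hg.
have Vh : hlt (h^-1 * (K * a)) (K * a) by exact: (hltV h K).1 HK.
case: (hle_total4 H K) => L.
- by apply: free_or_commensurableVr; apply: (F _ _ H (K * a)) => //; rewrite mulKa.
- exact: (F _ _ H K).
- apply: free_or_commensurableVr; apply: free_or_commensurableVl.
  by apply: (F _ _ (H * a) (K * a)) => //; rewrite mulKa.
- by apply: free_or_commensurableVl; apply: (F _ _ (H * a) K) => //; apply: hle_star.
Qed.

(** * Translations and torsion elements *)

(** Translations of the tree, whose axis passes through the edge of H. *)
Definition hyperbolic g := exists H, hlt (g * H) H.
(** The rotation of order 3 about the vertex at the origin of the base edge, from which the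
    half-trees 1, rho, rho^2 issue. *)
Definition rho := b * a * sh true.
(** The stabiliser of the base edge, a Klein four-group. *)
Definition D2 g := [\/ g = 1, g = b, g = a | g = a * b].
(** Up to conjugacy, the elements that preserve an edge or rotate about a vertex. *)
Definition elliptic g := exists H, [\/ D2 (g ^ H), g ^ H = rho | g ^ H = rho^-1].

Lemma hyperbolicJ g H : hyperbolic (g ^ H) -> hyperbolic g.
Proof.
move=> [K L]; exists (H * K); move: L; rewrite /hlt conjgE; gsimp => //.
Qed.
Lemma ellipticJ g H : elliptic (g ^ H) -> elliptic g.
Proof. by move=> [K L]; exists (H * K); rewrite conjgM. Qed.

Lemma elliptic_or_hyperbolicJ g H :
  elliptic (g ^ H) \/ hyperbolic (g ^ H) -> elliptic g \/ hyperbolic g.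
Proof. by case=> [/ellipticJ|/hyperbolicJ]; auto. Qed.

Lemma D2_elliptic g : D2 g -> elliptic g.
Proof. by move=> A; exists 1; rewrite conjg1; apply: Or31. Qed.

Lemma rhoE : rho = a * sh false * b.
Proof. by rewrite /rho -ab -!mulgA b_sh. Qed.
(** The reflection a (sh c) fixes another edge at an endpoint of the base edge. *)
Lemma reflection_conj c : (a * sh c) ^ (a * sh (~~ c)) = b.
Proof.
by rewrite conjgE invgM; gsimp; rewrite -!mulgA (mulgA (sh c)) sh_a_diff mulKg.
Qed.

(** The element a n maps T into its complement.  Conjugation by a and the first letter of n brings
    that letter behind the last one, with a in between: equal letters cancel and shorten n,
    different letters leave a translation. *)
Lemma classify_flip k w e : size w = k -> elliptic (a * nf w e) \/ hyperbolic (a * nf w e).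
Proof.
elim/ltn_ind: k w e => k IH [|c w] e /= sw.
  by left; apply: D2_elliptic; case: e; rewrite ?nf1 ?nfb ?mulg1; [apply: Or44|apply: Or43].
apply: (@elliptic_or_hyperbolicJ _ (a * sh c)).
have -> : (a * nf (c :: w) e) ^ (a * sh c) = nf w e * a * sh c.
  by rewrite conjgE nf_cons; gsimp.
case: (lastP w) sw => [|v d] sw.
  left; case: e; rewrite ?nf1 ?nfb ?mul1g.
    case: c {sw}; first by exists 1; apply: Or32; rewrite conjg1.
    exists b; apply: Or32; rewrite conjgE bV; gsimp.
    by rewrite bb mul1g rhoE.
  by exists (a * sh (~~ c)); rewrite reflection_conj; apply/Or31/Or42.
have -> : nf (rcons v d) e * a * sh c = word_prod v * (sh d * a * sh (e (+) c)) * b ^+ e.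
  rewrite /nf -cats1 word_prod_cat /= mulg1 -!mulgA; congr (_ * (_ * _)).
  have -> : sh (e (+) c) * b ^+ e = b ^+ e * sh c.
    by have := b_word_prod e [:: c]; rewrite /= !mulg1.
  by case: e; rewrite ?expg1 ?expg0 ?mul1g // !mulgA ab.
have [->|nd] := eqVneq d (e (+) c).
  rewrite sh_a_same; apply: (@elliptic_or_hyperbolicJ _ (word_prod v)).
  have -> : (word_prod v * a * b ^+ e) ^ word_prod v = a * nf (map (addb e) v) e.
    by rewrite conjgE -!mulgA mulKg b_word_prod.
  by apply: (IH (size v)); rewrite ?size_map //; move: sw; rewrite /= size_rcons; lia.
have -> : d = ~~ (e (+) c) by case: (d) (e) (c) nd => [] [] [].
right; exists 1; apply/hlt_conj; rewrite conjg1.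
have := sh_a_diff (~~ (e (+) c)); rewrite negbK => ->.
rewrite -!mulgA; apply: NMpos; first by exists v, false; rewrite /nf expg0 mulg1.
apply/NposP; exists (e (+) c), (b * b ^+ e); split=> //.
by apply: NM Nb _; case: (e); rewrite ?expg1 ?expg0; [apply: Nb|apply: N1].
Qed.

Lemma classify_N n : N n -> elliptic n \/ hyperbolic n.
Proof.
case/N_cases => [->|->|P]; last by right; exists 1; apply/hlt_conj; rewrite conjg1.
  by left; apply/D2_elliptic/Or41.
by left; apply/D2_elliptic/Or42.
Qed.

Lemma elliptic_or_hyperbolic g : elliptic g \/ hyperbolic g.
Proof.
have [[] [[]]] := orientation_cover g; rewrite ?expg1 ?expg0 ?mul1g ?mulg1 => Ng.
- by apply: (@elliptic_or_hyperbolicJ _ a); rewrite conjgE aV mulgA; apply: classify_N.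
- by case: Ng => w [e E]; rewrite -(mulaK g) E; apply: classify_flip (erefl _).
- apply: (@elliptic_or_hyperbolicJ _ a); rewrite conjgE aV.
  by case: Ng => w [e ->]; apply: classify_flip (erefl _).
- exact: classify_N.
Qed.

Lemma rho2E : rho ^+ 2 = a * sh true * b.
Proof.
have L : sh false * a * sh true = sh true * b := sh_a_diff false.
by rewrite expg2 {1}rhoE /rho; gsimp; rewrite mulKb -!mulgA (mulgA (sh false)) L.
Qed.
Lemma rho3 : rho ^+ 3 = 1.
Proof.
rewrite expgSr rho2E /rho; gsimp.
by rewrite mulKb -!mulgA (mulgA (sh true)) sh_a_same aa.
Qed.
Lemma rho_mod k : rho ^+ k = rho ^+ (k %% 3).
Proof. by rewrite {1}(divn_eq k 3) expgnDr mulnC expgnA rho3 expg1n mul1g. Qed.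
Lemma rho_eqmod k l : k = l %[mod 3] -> rho ^+ k = rho ^+ l.
Proof. by move=> e; rewrite rho_mod e -rho_mod. Qed.
Lemma rhoV : rho^-1 = rho ^+ 2.
Proof. by apply: mulg1_eq; rewrite -expgS rho3. Qed.
Lemma rhoXV k : rho ^- k = rho ^+ (2 * k)%N.
Proof. by rewrite -expVgn rhoV -expgnA. Qed.
Lemma b_rho k : b * rho ^+ k = rho ^+ (2 * k)%N * b.
Proof.
have e1 : b * rho = rho ^+ 2 * b.
  by rewrite rho2E mulKb /rho; gsimp; rewrite bb mul1g.
elim: k => [|k IH]; first by rewrite !expg0 mulg1 mul1g.
rewrite expgSr mulgA IH -mulgA e1 mulgA -expgnDr; congr (_ ^+ _ * _); lia.
Qed.
Lemma bX_rho (e : bool) k : exists l, b ^+ e * rho ^+ k = rho ^+ l * b ^+ e.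
Proof.
by case: e; [exists (2 * k)%N; rewrite expg1 b_rho|exists k; rewrite !expg0 mulg1 mul1g].
Qed.

(** The stabiliser of the vertex at the origin of the base edge, of order 6. *)
Definition D3 g := exists k (e : bool), g = rho ^+ k * b ^+ e.
Lemma D3_1 : D3 1. Proof. by exists 0, false; rewrite expg0 mulg1. Qed.
Lemma D3_M x y : D3 x -> D3 y -> D3 (x * y).
Proof.
move=> [k [e ->]] [l [f ->]]; have [l' E] := bX_rho e l.
exists (k + l')%N, (e (+) f).
by rewrite -mulgA (mulgA (b ^+ e)) E -expb_add expgnDr; gsimp.
Qed.
Lemma D3_rho k : D3 (rho ^+ k). Proof. by exists k, false; rewrite expg0 mulg1. Qed.
Lemma D3_b e : D3 (b ^+ e). Proof. by exists 0, e; rewrite expg0 mul1g. Qed.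
Lemma D3_V x : D3 x -> D3 x^-1.
Proof.
move=> [k [e ->]]; rewrite invgM rhoXV; apply: D3_M (D3_rho _).
by case: e; rewrite ?expg1 ?expg0 ?invg1 ?bV; [apply: (D3_b true)|apply: D3_1].
Qed.
Lemma shear_not_D3 c : ~ D3 (sh c).
Proof.
move=> [k [e]]; rewrite rho_mod.
have Nbe : N (b ^+ e) by rewrite -[b ^+ e]mul1g -[1]/(word_prod [::]); apply: N_nf.
case: (k %% 3) (ltn_pmod k (isT : 0 < 3)) => [|[|[|//]]] _ E.
- have : Npos (b ^+ e) by rewrite -[b ^+ e]mul1g -[1](expg0 rho) -E; apply/NposP; exists c, 1; rewrite mulg1; split=> //; apply: N1.
  by case: (e); rewrite ?expg1 ?expg0; [exact: Npos_notb|exact: Npos_not1].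
- by apply: (complement_disjoint (Nsh c) (NM (NM (Nsh false) Nb) Nbe)); rewrite E expg1 rhoE; gsimp.
- by apply: (complement_disjoint (Nsh c) (NM (NM (Nsh true) Nb) Nbe)); rewrite E rho2E; gsimp.
Qed.

Lemma elliptic_torsion g : elliptic g -> g ^+ 6 = 1.
Proof.
move=> [H E]; apply: (@conjg_inj _ H); rewrite conjXg conj1g.
have sq x : x * x = 1 -> x ^+ 6 = 1.
  by move=> xx; rewrite (expgnA x 2 3) expg2 xx expg1n.
case: E => [[] ->|->|->]; first by rewrite expg1n.
- exact: sq.
- exact: sq.
- by apply: sq; rewrite {2}ab mulgA mulKb aa.
- by rewrite (expgnA rho 3 2) rho3 expg1n.
- by rewrite expVgn (expgnA rho 3 2) rho3 expg1n invg1.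
Qed.

Lemma torsion_not_hlt g H : g ^+ 6 = 1 -> ~ hlt (g * H) H.
Proof.
move=> g6 /hltX/(_ (isT : 0 < 6)); rewrite g6 mul1g => L.
exact: (hlt_not_le L (hle_refl H)).
Qed.
Lemma torsion_le g H : g ^+ 6 = 1 -> hle (g * H) H -> H^-1 * (g * H) = 1 \/ H^-1 * (g * H) = b.
Proof. by move=> g6 /hle_hlt[/(torsion_not_hlt g6)|]. Qed.
Lemma hle_antisym u v : hle u v -> hle v u -> v^-1 * u = 1 \/ v^-1 * u = b.
Proof. by move=> /hle_hlt[/hlt_not_le|]. Qed.

(** * Ping-pong at an edge and at a vertex *)

(** A torsion y moves the complement of the half-tree containing its fixed points into that
    half-tree, below one child; a and a b then send this child to two different children on
    the other side of the base edge. *)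
Lemma edge_free_pair y : y ^+ 6 = 1 -> D2 y \/ free_pair (a * y) (a * b * y).
Proof.
move=> y6; have tN H : N (y ^ H) -> y ^ H = 1 \/ y ^ H = b.
  by rewrite conjgE => /torsion_le; apply.
have [[] [[]]] := orientation_cover y; rewrite ?expg1 ?expg0 ?mul1g ?mulg1 => Ny.
- have yE : y = a * (a * y * a) * a by rewrite !mulgA aa mul1g mulKa.
  have := tN a; rewrite conjgE aV mulgA => /(_ Ny) [] E; left; rewrite yE E.
    by apply: Or41; rewrite mulg1 aa.
  by apply: Or42; rewrite ab mulKa.
(* The base half-tree is mapped into its complement. *)
- have yE : y = a * (a * y) by rewrite mulaK.
  case/N_cases: Ny => [E|E|/NposP[c [m [Nm E]]]].
  + by left; apply: Or43; rewrite yE E mulg1.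
  + by left; apply: Or44; rewrite yE E.
  right; apply: (@free_pair_ping_pong _ _ _ N); first by exists 1; apply: N1.
  + by move=> p Np; rewrite E; do ?apply: NM => //; apply: Nsh.
  + by move=> p Np; rewrite ab -(mulgA b) E; do ?apply: NM => //; [apply: Nb|apply: Nsh].
  + move=> p q Np Nq; rewrite ab -(mulgA b) E (mulgA b) b_sh => F.
    have A : N (m * p) by apply: NM.
    have B : N (b * (m * q)) by apply/NM/NM => //; apply: Nb.
    have {}F : sh c * (m * p) = sh (~~ c) * (b * (m * q)) by rewrite !mulgA in F *.
    by case: c F {E} => /= F; [apply: (children_disjoint A B)|apply: (children_disjoint B A)].
(* The complement of the base half-tree is mapped into the base half-tree. *)
- have yE : y = (y * a) * a by rewrite mulKa.
  case/N_cases: Ny => [E|E|/NposP[c [m [Nm E]]]].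
  + by left; apply: Or43; rewrite yE E mul1g.
  + by left; apply: Or44; rewrite yE E ab.
  right; apply: (@free_pair_ping_pong _ _ _ (fun x => N (a * x))).
  + by exists a; rewrite aa; apply: N1.
  + move=> p Np; rewrite yE E.
    have -> : a * (a * (sh c * m * a) * p) = sh c * (m * (a * p)).
      by rewrite !mulgA aa mul1g.
    by apply/NM/NM => //; apply: Nsh.
  + move=> p Np; rewrite yE E.
    have -> : a * (a * b * (sh c * m * a) * p) = b * (sh c * (m * (a * p))).
      by rewrite !mulgA aa mul1g.
    by apply/NM/NM/NM => //; [apply: Nb|apply: Nsh].
  + move=> p q Np Nq F.
    have A : N (m * (a * p)) by apply: NM.
    have B : N (b * (m * (a * q))) by apply/NM/NM => //; apply: Nb.
    have {}F : sh c * (m * (a * p)) = sh (~~ c) * (b * (m * (a * q))).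
      rewrite (mulgA _ b) -b_sh; apply: (mulgI a); move: F; rewrite yE E.
      by rewrite !mulgA.
    by case: c F {E} => /= F; [apply: (children_disjoint A B)|apply: (children_disjoint B A)].
- by have := tN 1; rewrite conjg1 => /(_ Ny)[] ->; left; [apply: Or41|apply: Or42].
Qed.

Lemma hle_bX u v e : hle (u * b ^+ e) v <-> hle u v.
Proof.
have H x y : hle x y -> hle (x * b ^+ e) y.
  by move=> L; rewrite /hle mulgA; apply: NM L _; case: e; rewrite ?expg1 ?expg0; [apply: Nb|apply: N1].
split=> [/H|/H //]; rewrite -mulgA expb_add addbb expg0 mulg1 //.
Qed.

Lemma rho_disj k l : k != l %[mod 3] -> hle (rho ^+ k) (rho ^+ l * a).
Proof.
move=> nkl.
have -> : rho ^+ k = rho ^+ l * rho ^+ ((k + 2 * l) %% 3).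
  by rewrite -expgnDr; apply: rho_eqmod; rewrite modnDmr; lia.
rewrite /hle invgM aV -mulgA mulKg.
have : (k + 2 * l) %% 3 != 0 by lia.
case: (_ %% 3) (ltn_pmod (k + 2 * l)%N (isT : 0 < 3)) => [|[|[|//]]] // _ _.
  by rewrite expg1 rhoE -mulgA mulaK; apply: NM (Nsh _) Nb.
by rewrite rho2E -mulgA mulaK; apply: NM (Nsh _) Nb.
Qed.

(** The element y sends the half-trees issuing from the vertex in directions other than i into
    direction i, and d1, d2 send direction i to the two other directions, numbered m1 and m2. *)
Lemma vertex_free_pair y i (d1 d2 : G) (m1 m2 : nat) e1 e2 :
  (forall j, j != i %[mod 3] -> hle (y * rho ^+ j) (rho ^+ i)) ->
  d1 * rho ^+ i = rho ^+ m1 * b ^+ e1 -> d2 * rho ^+ i = rho ^+ m2 * b ^+ e2 ->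
  m1 != i %[mod 3] -> m2 != i %[mod 3] -> m1 != m2 %[mod 3] ->
  free_pair (d1 * y) (d2 * y).
Proof.
move=> Ly E1 E2 n1 n2 n12.
pose O x := exists2 j, j != i %[mod 3] & hle x (rho ^+ j).
have step (d : G) (m : nat) (e : bool) x : d * rho ^+ i = rho ^+ m * b ^+ e -> O x -> hle (d * y * x) (rho ^+ m).
  move=> E [j ji L]; apply: (@hle_trans _ (d * rho ^+ i)); last by rewrite E; apply/hle_bX/hle_refl.
  by rewrite -mulgA; apply/hle_mul; apply: hle_trans (Ly j ji); apply/hle_mul.
apply: (@free_pair_ping_pong _ _ _ O).
- by exists (rho ^+ m1); exists m1 => //; apply: hle_refl.
- by move=> x Ox; exists m1 => //; apply: step E1 Ox.
- by move=> x Ox; exists m2 => //; apply: step E2 Ox.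
move=> x x' Ox Ox' E; have A := step _ _ _ _ E1 Ox; have := step _ _ _ _ E2 Ox'.
by rewrite -E => /hle_disj; apply; apply: hle_trans A _; apply: rho_disj.
Qed.

Lemma D3_of_le y i j : hle (y * rho ^+ i) (rho ^+ j) -> hle (rho ^+ j) (y * rho ^+ i) -> D3 y.
Proof.
move=> A B; have -> : y = rho ^+ j * ((rho ^+ j)^-1 * (y * rho ^+ i)) * (rho ^+ i)^-1.
  by rewrite mulVKg mulgK.
apply: D3_M; last by apply/D3_V/D3_rho.
apply: D3_M (D3_rho _) _.
by case: (hle_antisym A B) => ->; [apply: (D3_b false)|apply: (D3_b true)].
Qed.

Lemma torsion_le_sym y u k : y ^+ 6 = 1 -> hle (y ^+ k * u) u -> hle u (y ^+ k * u).
Proof.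
move=> y6; have yk6 : (y ^+ k) ^+ 6 = 1 by rewrite -expgnA mulnC expgnA y6 expg1n.
case/(torsion_le yk6) => E; rewrite /hle -[_^-1 * u]invgK invgM invgK E ?invg1 ?bV.
  exact: N1.
exact: Nb.
Qed.

(** Write E for the half-tree in direction i.  As y is torsion, an inclusion between E and y E is
    an equality; and if y E lies in the complement of E, it is this complement or lies in one of
    its children, which are the half-trees in the two other directions. *)
Lemma vertex_trichotomy y i : y ^+ 6 = 1 ->
  [\/ D3 y, hle (y * (rho ^+ i * a)) (rho ^+ i)
    | exists2 j, j != i %[mod 3] & hle (y * rho ^+ i) (rho ^+ j)].
Proof.
move=> y6.
case: (hle_total4 (y * rho ^+ i) (rho ^+ i)) => L.
- by apply: Or31; apply: (D3_of_le L); apply: (@torsion_le_sym y (rho ^+ i) 1 y6 L).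
- case: (N_cases L) => [E|E|/NposP[c [m [Nm E]]]].
  + apply: Or32; rewrite mulgA -(mulVKg (rho ^+ i * a) (y * _)) E mulg1 mulKa.
    exact: hle_refl.
  + apply: Or32; rewrite mulgA -(mulVKg (rho ^+ i * a) (y * _)) E -mulgA -ab mulgA mulKa.
    exact/(hle_bX _ _ true)/hle_refl.
  have [k k0 ac] : exists2 k, k %% 3 != 0 & a * sh c = rho ^+ k * b.
    by case: (c); [exists 2 => //; rewrite rho2E mulKb|exists 1%N => //; rewrite expg1 rhoE mulKb].
  apply: Or33; exists (i + k)%N; first by lia.
  have -> : y * rho ^+ i = rho ^+ (i + k) * (b * m).
    by rewrite expgnDr -(mulVKg (rho ^+ i * a) (y * _)) E -!mulgA (mulgA a) ac !mulgA.
  by rewrite /hle mulKg; apply: NM Nb Nm.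
- by apply: Or32; rewrite mulgA.
- apply: Or31; apply: D3_of_le (L).
  (* Here y^5 is the inverse of y. *)
  have L' : hle (y ^+ 5 * rho ^+ i) (rho ^+ i).
    by apply/(hle_mul y); rewrite mulgA -expgS y6 mul1g.
  have := torsion_le_sym y6 L' => /(hle_mul y); rewrite mulgA -expgS y6 mul1g //.
Qed.

(** If y sends the half-tree in each direction into one in another direction, the induced map of
    the three directions has a cycle, and a power of y maps a half-tree into itself, hence onto
    itself since y is torsion.  Then y maps half-trees along the cycle onto each other and fixes
    the vertex. *)
Lemma vertex_dichotomy y : y ^+ 6 = 1 ->
  D3 y \/ exists i, forall j, j != i %[mod 3] -> hle (y * rho ^+ j) (rho ^+ i).
Proof.
move=> y6.
have B i : hle (y * (rho ^+ i * a)) (rho ^+ i) -> 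
    D3 y \/ exists i, forall j, j != i %[mod 3] -> hle (y * rho ^+ j) (rho ^+ i).
  move=> L; right; exists i => j ji; apply: hle_trans L; apply/hle_mul; exact: rho_disj.
have cyc2 i j : hle (y * rho ^+ i) (rho ^+ j) -> hle (y * rho ^+ j) (rho ^+ i) -> D3 y.
  move=> Lij Lji; have L2 : hle (y ^+ 2 * rho ^+ i) (y * rho ^+ j).
    by rewrite expg2 -mulgA; apply/hle_mul.
  apply: (D3_of_le Lji); apply: hle_trans (L2); apply: torsion_le_sym => //.
  exact: hle_trans L2 Lji.
have cyc3 i j k : hle (y * rho ^+ i) (rho ^+ j) -> hle (y * rho ^+ j) (rho ^+ k) ->
    hle (y * rho ^+ k) (rho ^+ i) -> D3 y.
  move=> Lij Ljk Lki; have L3 : hle (y ^+ 3 * rho ^+ i) (y * rho ^+ k).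
    rewrite expgS -mulgA; apply/hle_mul; apply: hle_trans Ljk.
    by rewrite expg2 -mulgA; apply/hle_mul.
  apply: (D3_of_le Lki); apply: hle_trans (L3); apply: torsion_le_sym => //.
  exact: hle_trans L3 Lki.
have C i : (D3 y \/ exists i, forall j, j != i %[mod 3] -> hle (y * rho ^+ j) (rho ^+ i)) \/
    hle (y * rho ^+ i) (rho ^+ i.+1) \/ hle (y * rho ^+ i) (rho ^+ i.+2).
  case: (vertex_trichotomy i y6) => [D|/B|[j ji L]]; [by left; left|by left|right].
  have [e|e] : j = i.+1 %[mod 3] \/ j = i.+2 %[mod 3] by lia.
    by left; rewrite -(rho_eqmod e).
  by right; rewrite -(rho_eqmod e).
case: (C 0) => [//|C0]; case: (C 1%N) => [//|C1]; case: (C 2) => [//|C2].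
have E3 : rho ^+ 3 = rho ^+ 0 by rewrite rho3.
have E4 : rho ^+ 4 = rho ^+ 1%N by apply: rho_eqmod.
rewrite E3 in C1 C2; rewrite E4 in C2.
left; case: C0 C1 C2 => C0 [] C1 [] C2.
- exact: cyc3 C0 C1 C2.
- exact: cyc2 C1 C2.
- exact: cyc2 C0 C1.
- exact: cyc2 C0 C1.
- exact: cyc2 C0 C2.
- exact: cyc2 C1 C2.
- exact: cyc2 C0 C2.
- exact: cyc3 C0 C2 C1.
Qed.

(** * Short free pairs in a generating set *)

Lemma commensurable_trans g h x : commensurable g h -> commensurable h x -> commensurable g x.
Proof.
move=> [i [j [i0 j0 E]]] [k [l [k0 l0 F]]]; exists (i * k)%N, (l * j)%N.
split; rewrite ?muln_gt0 ?i0 ?j0 ?k0 ?l0 //.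
have {}F : h ^+ (j * k) = x ^+ (l * j) \/ h ^+ (j * k) = x ^- (l * j).
  by rewrite mulnC !expgnA; case: F => ->; [left|right; rewrite expVgn].
have {}E : g ^+ (i * k) = h ^+ (j * k) \/ g ^+ (i * k) = h ^- (j * k).
  by rewrite !expgnA; case: E => ->; [left|right; rewrite expVgn].
by case: E => ->; case: F => ->; rewrite ?invgK; auto.
Qed.

Lemma commensurableJ g h x : commensurable g h -> commensurable (g ^ x) (h ^ x).
Proof.
move=> [i [j [i0 j0 E]]]; exists i, j; split=> //.
by rewrite -!conjXg -conjVg; case: E => ->; auto.
Qed.

(** Let V be the sibling of the child of U that contains g U.  A power of g that translates
    through V, in either direction, maps V to a half-tree comparable with V, whereas positive
    powers of g map V into the other child. *)
Lemma commensurator_not_all g : hyperbolic g -> ~ forall t, commensurable g (g ^ t).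
Proof.
move=> [U gU] C; have /hlt_conj/NposP[c [n [Nn E]]] := gU.
set V := U * sh (~~ c).
(* The conjugate of g by this element translates through V. *)
have [i [j [i0 j0 Eij]]] := C (U * V^-1).
have disj u : hle u (U * sh c) -> ~ hle u V.
  rewrite /hle /V !invgM -!mulgA; set z := U^-1 * u => A B.
  have Ez d : z = sh d * ((sh d)^-1 * z) by rewrite mulVKg.
  by case: c {V C Eij E} A B => A B; [apply: (children_disjoint A B)|apply: (children_disjoint B A)]; rewrite -!Ez.
have gUc : hle (g * U) (U * sh c).
  by rewrite /hle invgM -mulgA -conjgE E mulKg.
have giV : hle (g ^+ i * V) (U * sh c).
  apply: hle_trans (gUc); case: i i0 {Eij} => // i _.
  rewrite expgS -mulgA; apply/hle_mul.
  have LV : hle V U by rewrite /V /hle mulKg; apply: Nsh.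
  apply: (@hle_trans _ (g ^+ i * U)); first exact/hle_mul.
  by case: i => [|i]; [rewrite expg0 mul1g; apply: hle_refl|apply/hltW/hltX].
have sV : hlt ((g ^ (U * V^-1)) ^+ j * V) V.
  have -> : (g ^ (U * V^-1)) ^+ j * V = V * U^-1 * (g ^+ j * U).
    by rewrite -conjXg conjgE invgM invgK -!mulgA mulVg mulg1.
  by rewrite -[X in hlt _ X](mulgVK U V); apply/hlt_mul/hltX.
case: Eij => E'; rewrite E' in giV.
  exact: disj giV (hltW sV).
apply: disj (hle_refl V); apply: hle_trans giV.
by apply/(hle_mul ((g ^ (U * V^-1)) ^+ j)); rewrite mulVKg; apply: hltW.
Qed.

Section Generators.
Variable S : set G.
Hypothesis S_generates : generates S.
Local Notation B := (word_ball S).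

Let S_gen := generates_ind S_generates.
Let B1 x : S x -> B 1 x. Proof. exact: word_ball_gen. Qed.
Let BM k l x y : B k x -> B l y -> B (k + l) (x * y). Proof. exact: word_ballM. Qed.
Let BV k x : B k x -> B k x^-1. Proof. exact: word_ballV. Qed.
Let BW k l x : k <= l -> B k x -> B l x. Proof. exact: word_ballW. Qed.

(** Words of lengths 2 and 3: the case of equality in alpha^-2 + alpha^-3 = 1. *)
Definition short_free_pair := exists x y, [/\ B 2 x, B 3 y & free_pair x y].

Lemma short_free_pairJ H k l x y : B k x -> B l y -> k <= 2 -> l <= 3 ->
  free_pair (x ^ H) (y ^ H) -> short_free_pair.
Proof.
move=> Bx By k2 l3 /free_pairJ F; exists x, y; split=> //; [exact: BW Bx|exact: BW By].
Qed.

Lemma short_or_commensurable k l g h : B k g -> B l h -> k <= 2 -> l <= 3 ->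
  free_or_commensurable g h -> short_free_pair \/ commensurable g h.
Proof.
move=> Bg Bh k2 l3 [[g' [h' [eg eh F]]]|]; [left|by right].
exists g', h'; split=> //.
  by apply: (@BW k) => //; case: eg => ->; rewrite // ; apply: BV.
by apply: (@BW l) => //; case: eh => ->; rewrite // ; apply: BV.
Qed.

Lemma not_all_torsion2 : ~ forall x, x * x = 1.
Proof.
move=> /(_ (sh true)) E; apply: Npos_not1; rewrite -E; apply/NposP.
by exists true, (sh true); split=> //; apply: Nsh.
Qed.

(** A translation s and its conjugates by elements of S have lengths 1 and 3; if s were
    commensurable to all of them, S would generate a subgroup that commensurates s. *)
Lemma short_hyperbolic s : S s -> hyperbolic s -> short_free_pair.
Proof.
move=> Ss Hs; apply: contrapT => nF; apply: (commensurator_not_all Hs).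
apply: S_gen.
- by exists 1%N, 1%N; rewrite conjg1; split=> //; left.
- move=> x y Cx Cy; rewrite conjgM.
  exact: commensurable_trans Cy (commensurableJ _ Cx).
- move=> x /(commensurableJ x^-1); rewrite conjgK; exact: commensurable_sym.
move=> t St; have Bst : B 3 (s ^ t).
  by rewrite conjgE; apply: (BM (k := 1) (l := 2)); [apply/BV/B1|apply: (BM (k := 1) (l := 1)); apply: B1].
have [H L] := Hs.
have L' : hlt (s ^ t * (t^-1 * H)) (t^-1 * H).
  by rewrite conjgE -!mulgA mulVKg; apply/hlt_mul.
by have [] := short_or_commensurable (B1 Ss) Bst isT isT (hyperbolic_pair L L').
Qed.

(** An element of S outside the vertex stabiliser exists, since S generates the group; P is
    whatever such an element provides. *)
Lemma not_all_in_D3 H (P : Prop) :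
  (forall t, S t -> P \/ D3 (t ^ H)) -> P.
Proof.
move=> PD; apply: contrapT => nP.
have : forall g, D3 (g ^ H).
  apply: S_gen.
  - by rewrite conj1g; apply: D3_1.
  - by move=> x y; rewrite conjMg; apply: D3_M.
  - by move=> x; rewrite conjVg; apply: D3_V.
  - by move=> t /PD[].
by move/(_ (sh true ^ H^-1)); rewrite conjgKV; apply: shear_not_D3.
Qed.

Lemma D2_1 : D2 1. Proof. exact: Or41. Qed.
Lemma D2_gen (i j : bool) : D2 (a ^+ i * b ^+ j).
Proof.
by case: i j => [] []; rewrite ?expg1 ?expg0 ?mul1g ?mulg1; [apply: Or44|apply: Or43|apply: Or42|apply: Or41].
Qed.
Lemma D2P x : D2 x <-> exists i j : bool, x = a ^+ i * b ^+ j.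
Proof.
split=> [|[i [j ->]]]; last exact: D2_gen.
case=> ->; [exists false, false|exists false, true|exists true, false|exists true, true];
  by rewrite ?expg1 ?expg0 ?mul1g ?mulg1.
Qed.
Lemma D2_M x y : D2 x -> D2 y -> D2 (x * y).
Proof.
move=> /D2P[i [j ->]] /D2P[k [l ->]]; apply/D2P; exists (i (+) k), (j (+) l).
have -> : a ^+ i * b ^+ j * (a ^+ k * b ^+ l) = a ^+ i * a ^+ k * (b ^+ j * b ^+ l).
  rewrite -!mulgA; congr (_ * _); rewrite !mulgA; congr (_ * _).
  by case: j k => [] []; rewrite ?expg1 ?expg0 ?mul1g ?mulg1.
rewrite expb_add; congr (_ * _).
by case: i k => [] []; rewrite ?expg1 ?expg0 ?mul1g ?mulg1.
Qed.
Lemma D2_sq x : D2 x -> x * x = 1.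
Proof. by case=> ->; rewrite ?mul1g // {2}ab mulgA mulKb. Qed.
Lemma D2_V x : D2 x -> D2 x^-1.
Proof. by move=> Dx; rewrite (mulg1_eq (D2_sq Dx)). Qed.

(** The same for the edge stabiliser, all of whose elements have trivial square. *)
Lemma not_all_in_D2 H (P : Prop) :
  (forall t, S t -> P \/ D2 (t ^ H)) -> P.
Proof.
move=> PD; apply: contrapT => nP; apply: not_all_torsion2 => x.
suff : forall g, D2 (g ^ H) by move/(_ (x ^ H^-1)); rewrite conjgKV; apply: D2_sq.
apply: S_gen.
- by rewrite conj1g; apply: D2_1.
- by move=> y z; rewrite conjMg; apply: D2_M.
- by move=> y; rewrite conjVg; apply: D2_V.
- by move=> t /PD[].
Qed.

Hypothesis S_tors : forall s, S s -> s ^+ 6 = 1.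

Lemma torsion_conj s H : S s -> (s ^ H) ^+ 6 = 1.
Proof. by move=> Ss; rewrite -conjXg S_tors // conj1g. Qed.

Lemma rotation_pair y : y ^+ 6 = 1 -> D3 y \/ free_pair (rho * y) (rho^-1 * y).
Proof.
case/vertex_dichotomy=> [|[i L]]; [by left|right].
apply: (vertex_free_pair L (e1 := false) (e2 := false) (m1 := i.+1) (m2 := i.+2)); try lia.
  by rewrite -expgS expg0 mulg1.
by rewrite rhoV -expgnDr expg0 mulg1.
Qed.

(** The rotation r and its inverse send the direction of the fixed points of t to the two other
    directions, so r t and r^-1 t play ping-pong. *)
Lemma short_order3 s H : S s -> s ^ H = rho \/ s ^ H = rho^-1 -> short_free_pair.
Proof.
move=> Ss sH; apply: (@not_all_in_D3 H) => t St.
case: (rotation_pair (torsion_conj H St)) => [|F]; [by right|left].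
have [r [Br rH]] : exists r, B 1 r /\ r ^ H = rho.
  case: sH => E; [exists s|exists s^-1]; rewrite ?conjVg ?E ?invgK; split=> //; first exact: B1.
  exact/BV/B1.
apply: (@short_free_pairJ H 2 2 (r * t) (r^-1 * t)) => //.
- by apply: (BM (k := 1) (l := 1)) => //; apply: B1.
- by apply: (BM (k := 1) (l := 1)); [apply: BV|apply: B1].
- by rewrite !conjMg conjVg rH.
Qed.

(** Two of the three involutions a, b, a b of an edge stabiliser give a and a b as words of
    lengths 1 and 2 in some order; a factor z that moves the edge makes lengths 2 and 3. *)
Lemma short_edge s t H : S s -> S t -> s ^ H <> t ^ H -> s ^ H <> 1 -> t ^ H <> 1 ->
  D2 (s ^ H) -> D2 (t ^ H) -> short_free_pair.
Proof.
move=> Ss St nst ns nt Ds Dt.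
have [x [y [Bxy xH yH]]] : exists x y, [/\ (B 1 x /\ B 2 y) \/ (B 2 x /\ B 1 y), x ^ H = a & y ^ H = a * b].
  have Bs := B1 Ss; have Bt := B1 St.
  have Bst : B 2 (s * t) by apply: (BM Bs Bt).
  have Bst' : B 2 (t * s) by apply: (BM Bt Bs).
  have W x : B 1 x -> B 2 x by apply: BW.
  case: Ds nst ns => Es; case: Dt nt => Et nt nst ns; rewrite ?Es ?Et // in nst ns nt.
  - by exists t, (t * s); rewrite conjMg Es Et; split; auto.
  - by exists (t * s), t; rewrite conjMg Es Et mulKb; split; auto.
  - by exists s, (s * t); rewrite conjMg Es Et; split; auto.
  - by exists s, t; rewrite Es Et; split; auto.
  - by exists (s * t), s; rewrite conjMg Es Et mulKb; split; auto.
  - by exists t, s; rewrite Es Et; split; auto.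
apply: (@not_all_in_D2 H) => z Sz.
case: (edge_free_pair (torsion_conj H Sz)) => [|F]; [by right|left].
case: Bxy => -[Bx By].
  apply: (@short_free_pairJ H 2 3 (x * z) (y * z)) => //.
  - by apply: (BM (k := 1) (l := 1)) => //; apply: B1.
  - by apply: (BM (k := 2) (l := 1)) => //; apply: B1.
  - by rewrite !conjMg xH yH.
apply: (@short_free_pairJ H 2 3 (y * z) (x * z)) => //.
- by apply: (BM (k := 1) (l := 1)) => //; apply: B1.
- by apply: (BM (k := 2) (l := 1)) => //; apply: B1.
- by rewrite !conjMg xH yH; apply: free_pairC.
Qed.

Lemma D3_involution x : D3 x -> x * x = 1 -> x <> 1 -> exists k, x = rho ^+ k * b.
Proof.
move=> [k [[] ->]]; first by exists k; rewrite expg1.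
rewrite expg0 mulg1 -expg2 -expgnA => E []; rewrite -(mul1g (rho ^+ k)) -E -expgnDr.
by rewrite (rho_eqmod (l := 0)) //; lia.
Qed.

(** Let i be the direction of the fixed points of z at the common vertex.  If neither reflection
    fixes direction i, they send it to the two other directions; if one of them does, the other
    one and their product do so. *)
Lemma short_reflections s t H : S s -> S t -> s * s = 1 -> t * t = 1 ->
  s <> 1 -> t <> 1 -> s <> t -> D3 (s ^ H) -> D3 (t ^ H) -> short_free_pair.
Proof.
move=> Ss St ss tt s1 t1 st Ds Dt.
have J x : x * x = 1 -> x ^ H * x ^ H = 1 by move=> xx; rewrite -conjMg xx conj1g.
have J1 x : x <> 1 -> x ^ H <> 1 by move=> x1; rewrite -(conj1g H) => /conjg_inj.
have [k Ek] := D3_involution Ds (J _ ss) (J1 _ s1).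
have [l El] := D3_involution Dt (J _ tt) (J1 _ t1).
have nkl : k != l %[mod 3].
  apply/eqP => /rho_eqmod E; apply: st; apply: (@conjg_inj _ H).
  by rewrite Ek El E.
apply: (@not_all_in_D3 H) => z Sz.
case: (vertex_dichotomy (torsion_conj H Sz)) => [|[i L]]; [by right|left].
have act (m n : nat) : rho ^+ m * b * rho ^+ n = rho ^+ (m + 2 * n)%N * b ^+ true.
  by rewrite -mulgA b_rho mulgA -expgnDr.
have act2 (m n p : nat) : rho ^+ m * b * (rho ^+ n * b) * rho ^+ p = rho ^+ (m + 2 * (n + 2 * p))%N * b ^+ false.
  by rewrite -mulgA act mulgA act -mulgA expb_add.
have Bs := B1 Ss; have Bt := B1 St; have Bz := B1 Sz.
have [e|ki] := eqVneq ((k + 2 * i) %% 3)%N (i %% 3)%N.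
  apply: (@short_free_pairJ H 2 3 (t * z) (s * t * z)) => //.
  - exact: BM Bt Bz.
  - exact: BM (BM Bs Bt) Bz.
  rewrite !conjMg Ek El; apply: (vertex_free_pair L (act l i) (act2 k l i)); lia.
have [e|li] := eqVneq ((l + 2 * i) %% 3)%N (i %% 3)%N.
  apply: (@short_free_pairJ H 2 3 (s * z) (t * s * z)) => //.
  - exact: BM Bs Bz.
  - exact: BM (BM Bt Bs) Bz.
  rewrite !conjMg Ek El; apply: (vertex_free_pair L (act k i) (act2 l k i)); lia.
apply: (@short_free_pairJ H 2 2 (s * z) (t * z)) => //.
- exact: BM Bs Bz.
- exact: BM Bt Bz.
rewrite !conjMg Ek El; apply: (vertex_free_pair L (act k i) (act l i)); lia.
Qed.

(** If y commutes with d, the pair given by the edge of d satisfies a relation. *)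
Lemma commuting_involution_D2 y (d : G) : y * y = 1 -> d <> 1 -> D2 d -> commute y d -> D2 y.
Proof.
move=> yy d1 Dd C.
case: (@edge_free_pair y); [by rewrite (expgnA y 2 3) expg2 yy expg1n|done|move=> F].
case: Dd d1 C => -> // _ C.
- case: (free_pair_not_comm F).
  have -> : a * b * y = a * y * b by rewrite -!mulgA C.
  by rewrite -[in RHS](mulgA (a * y)) (mulgA b) -ab !mulgA -(mulgA _ y b) C !mulgA.
- case: (free_pair_neq1 (n := 2) F) => //.
  by rewrite expg2 -{1}C mulgA -(mulgA y) aa mulg1 yy.
- case: (free_pair_neq1 (n := 2) (free_pairC F)) => //.
  by rewrite expg2 -{1}C mulgA -(mulgA y) D2_sq ?mulg1 ?yy //; apply: Or44.
Qed.

(** If y inverts the rotation r, then r y is an involution and belongs to no free pair. *)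
Lemma inverting_involution_D3 y r : y * y = 1 -> r = rho \/ r = rho^-1 -> y * r * y = r^-1 -> D3 y.
Proof.
move=> yy er E.
case: (@rotation_pair y); [by rewrite (expgnA y 2 3) expg2 yy expg1n|done|move=> F].
have [z n0] : exists z, free_pair (r * y) z.
  case: er => ->; [by exists (rho^-1 * y)|by exists (rho * y); apply: free_pairC].
case: (free_pair_neq1 (n := 2) n0) => //.
by rewrite expg2 -mulgA (mulgA y) E mulgV.
Qed.

(** If s t is not a translation, then s and t, which invert it, both preserve its fixed edge or
    vertex. *)
Lemma short_product_hyperbolic s t : S s -> S t -> s * s = 1 -> t * t = 1 ->
  s <> 1 -> t <> 1 -> s <> t -> short_free_pair \/ hyperbolic (s * t).
Proof.
move=> Ss St ss tt s1 t1 st.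
case: (elliptic_or_hyperbolic (s * t)) => [[H E]|]; [left|by right].
have sV : s^-1 = s by apply: mulg1_eq.
have tV : t^-1 = t by apply: mulg1_eq.
have J x : x * x = 1 -> x ^ H * x ^ H = 1 by move=> xx; rewrite -conjMg xx conj1g.
have J1 x : x <> 1 -> x ^ H <> 1 by move=> x1; rewrite -(conj1g H) => /conjg_inj.
have st' : s ^ H <> t ^ H by move/conjg_inj.
have st1 : s * t <> 1 by move=> e; apply: st; rewrite -[LHS]mulg1 -{1}tt mulgA e mul1g.
have Inv : s ^ H * (s * t) ^ H * s ^ H = ((s * t) ^ H)^-1.
  by rewrite -!conjMg -conjVg invgM sV tV; congr (_ ^ H); rewrite mulgA ss mul1g.
have Inv' : t ^ H * (s * t) ^ H * t ^ H = ((s * t) ^ H)^-1.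
  by rewrite -!conjMg -conjVg invgM sV tV; congr (_ ^ H); rewrite -!mulgA tt mulg1.
have rot : (s * t) ^ H = rho \/ (s * t) ^ H = rho^-1 -> short_free_pair.
  move=> er; apply: (@short_reflections s t H) => //.
    exact: inverting_involution_D3 (J _ ss) er Inv.
  exact: inverting_involution_D3 (J _ tt) er Inv'.
case: E => [Dd|e|e]; [|by apply: rot; left|by apply: rot; right].
have dV := mulg1_eq (D2_sq Dd).
have comm y : y * y = 1 -> y * (s * t) ^ H * y = ((s * t) ^ H)^-1 -> D2 y.
  move=> yy E; apply: (commuting_involution_D2 yy (J1 _ st1) Dd).
  by move: dV E; move: (_ ^ H) => d dV E; rewrite /commute -{2}dV -E -!mulgA yy mulg1.
by apply: (@short_edge s t H); auto.
Qed.

Hypothesis S_inv : forall s, S s -> s * s = 1.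

(** All products x t of distinct nontrivial elements are translations.  If no two of them form a
    free pair, they are commensurable to g = x y; as x inverts g, every t = x (x t) of S
    commensurates g, and so does the whole group. *)
Lemma short_involutions : short_free_pair.
Proof.
apply: contrapT => nF.
have hyp s t : S s -> S t -> s <> 1 -> t <> 1 -> s <> t -> hyperbolic (s * t).
  by move=> Ss St s1 t1 st; case: (short_product_hyperbolic Ss St (S_inv Ss) (S_inv St) s1 t1 st).
have [x Sx x1] : exists2 x, S x & x <> 1.
  apply: contrapT => nx; apply: not_all_torsion2 => x.
  suff A : forall g, g = 1 by rewrite (A x) mulg1.
  apply: S_gen => [||y ->|y Sy]; rewrite ?invg1 //; first by move=> y z -> ->; rewrite mulg1.
  by apply: contrapT => y1; apply: nx; exists y.
have [y [Sy y1 xy]] : exists y, [/\ S y, y <> 1 & x <> y].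
  apply: contrapT => ny; apply: not_all_torsion2.
  suff P g : g = 1 \/ g = x by move=> g; case: (P g) => ->; rewrite ?mulg1 // S_inv.
  have xV : x^-1 = x by apply/mulg1_eq/S_inv.
  elim/S_gen: g => [|y z [] -> [] ->|y [] ->|y Sy]; rewrite ?invg1 ?mulg1 ?mul1g ?xV ?S_inv; auto.
  by apply: contrapT => /not_orP[y1 yx]; apply: ny; exists y; split=> // e; apply: yx.
have xx := S_inv Sx; have xV := mulg1_eq xx.
apply: (commensurator_not_all (hyp _ _ Sx Sy x1 y1 xy)); set g := x * y.
have gx : g ^ x = g^-1.
  by rewrite conjgE /g invgM xV (mulg1_eq (S_inv Sy)) !mulgA xx mul1g.
apply: S_gen.
- by exists 1%N, 1%N; rewrite conjg1; split=> //; left.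
- move=> u v Cu Cv; rewrite conjgM.
  exact: commensurable_trans Cv (commensurableJ _ Cu).
- move=> u /(commensurableJ u^-1); rewrite conjgK; exact: commensurable_sym.
move=> t St.
have [->|/eqP t1] := eqVneq t 1.
  by exists 1%N, 1%N; rewrite conjg1; split=> //; left.
have [xt|/eqP xt] := eqVneq x t.
  by exists 1%N, 1%N; split=> //; right; rewrite -xt gx ?invgK.
have [H L] := hyp _ _ Sx Sy x1 y1 xy; have [K M] := hyp _ _ Sx St x1 t1 xt.
have [//|[i [j [i0 j0 E]]]] := short_or_commensurable
  (BM (B1 Sx) (B1 Sy)) (BM (B1 Sx) (B1 St)) isT isT (hyperbolic_pair L M).
have C : (g ^+ i) ^ (x * t) = g ^+ i.
  have Cx : commute (g ^+ i) (x * t).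
    apply/commute_sym; case: E => ->; first exact/commuteX/commute_refl.
    exact/commuteV/commuteX/commute_refl.
  by rewrite conjgE Cx mulKg.
exists i, i; split=> //; right.
have -> : g ^ t = (g ^ x) ^ (x * t) by rewrite -conjgM mulgA xx mul1g.
by rewrite gx -conjXg expVgn conjVg C invgK.
Qed.
End Generators.

Theorem short_free_pair_exists (S : set G) : generates S -> short_free_pair S.
Proof.
move=> Sg.
have [[s Ss Hs]|nH] := pselect (exists2 s, S s & hyperbolic s).
  exact (short_hyperbolic Sg Ss Hs).
have S_ell s : S s -> elliptic s.
  by move=> Ss; case: (elliptic_or_hyperbolic s) => // Hs; case: nH; exists s.
have S_tors s : S s -> s ^+ 6 = 1 by move/S_ell/elliptic_torsion.
have [[s [H [Ss sH]]]|nR] := pselect (exists s H, S s /\ (s ^ H = rho \/ s ^ H = rho^-1)).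
  exact (short_order3 Sg S_tors Ss sH).
apply (short_involutions Sg S_tors) => s Ss.
case: (S_ell s Ss) => H [D|E|E].
- by apply: (@conjg_inj _ H); rewrite conjMg conj1g; apply: D2_sq.
- by case: nR; exists s, H; auto.
- by case: nR; exists s, H; auto.
Qed.
End HalfTrees.

Local Open Scope classical_set_scope.
Local Open Scope ring_scope.
(** * Projective classes of integral 2 x 2 matrices *)

Section Matrices.
Implicit Types (p q r s t u v w : int).

Definition mx2 p q r s : 'M[int]_2 :=
  \matrix_(i, j) (if i == 0 then if j == 0 then p else q else if j == 0 then r else s).

Lemma ord2P (i : 'I_2) : i = 0 \/ i = 1.
Proof. by case: i => [[|[|//]] H]; [left|right]; apply/val_inj. Qed.

Lemma mx2_eta (A : 'M[int]_2) : A = mx2 (A 0 0) (A 0 1) (A 1 0) (A 1 1).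
Proof. by apply/matrixP => i j; rewrite mxE; case: (ord2P i) => ->; case: (ord2P j) => ->. Qed.

Lemma mx2_inj p q r s p' q' r' s' : mx2 p q r s = mx2 p' q' r' s' ->
  [/\ p = p', q = q', r = r' & s = s'].
Proof.
move/matrixP => E; have := (E 0 0, E 0 1, E 1 0, E 1 1).
by rewrite !mxE /= => -[[[-> ->] ->] ->].
Qed.

Lemma mul_mx2 p q r s p' q' r' s' : mx2 p q r s *m mx2 p' q' r' s' =
  mx2 (p * p' + q * r') (p * q' + q * s') (r * p' + s * r') (r * q' + s * s').
Proof.
apply/matrixP => i j; rewrite !mxE !big_ord_recl big_ord0 addr0 !mxE /=.
by case: (ord2P i) => ->; case: (ord2P j) => ->.
Qed.

Lemma scalar_mx2 t : t%:M = mx2 t 0 0 t.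
Proof. by apply/matrixP => i j; rewrite !mxE; case: (ord2P i) => ->; case: (ord2P j) => ->. Qed.

Lemma det_mx2 p q r s : \det (mx2 p q r s) = p * s - q * r.
Proof.
rewrite (expand_det_row _ 0) !big_ord_recl big_ord0 addr0 /cofactor !det_mx11 !mxE /=.
by rewrite !mul1r expr1 mulN1r mulrN.
Qed.

Definition pm1 t := t = 1 \/ t = -1.

Lemma pm1P t : reflect (pm1 t) (t \is a GRing.unit).
Proof.
rewrite qualifE /=; apply: (iffP orP) => -[/eqP|/eqP] ->; by [left|right].
Qed.

Lemma unit_mx2 p q r s : (mx2 p q r s \in unitmx) <-> pm1 (p * s - q * r).
Proof. by rewrite unitmxE det_mx2; split=> /pm1P. Qed.

(** A projective class does not determine its matrix; stating equalities through any matrix of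
    the class avoids the choice of representatives. *)
Definition represents (x : PGL 2 int) p q r s :=
  exists A : GL 2 int, GLmx A = mx2 p q r s /\ \pi_(PGL 2 int)%qT A = x.

Lemma represents_exists x : exists p q r s, represents x p q r s.
Proof.
elim/quotW: x => A; do 4!eexists; exists A; split; [exact: mx2_eta|by []].
Qed.

Lemma represents_det x p q r s : represents x p q r s -> pm1 (p * s - q * r).
Proof. by move=> [A [EA _]]; apply/unit_mx2; rewrite -EA GLmx_unit. Qed.

Lemma represents_mk p q r s : pm1 (p * s - q * r) -> exists x, represents x p q r s.
Proof.
by move/unit_mx2 => H; exists (\pi_(PGL 2 int)%qT (MkGL H)), (MkGL H).
Qed.

Lemma represents1 : represents 1%g 1 0 0 1.
Proof. by exists 1%g; rewrite GLmx1 scalar_mx2; split=> //; apply: PGL_pi1. Qed.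

Lemma representsM x y p q r s p' q' r' s' :
  represents x p q r s -> represents y p' q' r' s' ->
  represents (x * y)%g (p * p' + q * r') (p * q' + q * s') (r * p' + s * r') (r * q' + s * s').
Proof.
move=> [A [EA <-]] [C [EC <-]]; exists (A * C)%g; split.
  by rewrite GLmxM EA EC mul_mx2.
exact: PGL_piM.
Qed.

(** Only the sign of a matrix is lost in PGL(2,Z). *)
Lemma represents_uniq x p q r s p' q' r' s' : represents x p q r s -> represents x p' q' r' s' ->
  [/\ p = p', q = q', r = r' & s = s'] \/ [/\ p = - p', q = - q', r = - r' & s = - s'].
Proof.
move=> Rx Rx'; have dx := represents_det Rx; have dx' := represents_det Rx'.
move: Rx Rx' => [A [EA <-]] [C [EC]] /eqmodP/PGL_eqvP[t].
rewrite EA EC scalar_mx2 mul_mx2 !mul0r !addr0 !add0r => /mx2_inj[ep eq er es].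
have : pm1 t.
  apply/pm1P; have : t * t * (p' * s' - q' * r') \is a GRing.unit.
    by apply/pm1P; move: dx; rewrite ep eq er es; congr pm1; ring.
  by rewrite !unitrM -andbA => /andP[].
by case=> et; [left|right]; rewrite ep eq er es et ?mul1r ?mulN1r.
Qed.

Lemma represents_eq x y p q r s p' q' r' s' : represents x p q r s -> represents y p' q' r' s' ->
  [/\ p = p', q = q', r = r' & s = s'] \/ [/\ p = - p', q = - q', r = - r' & s = - s'] -> x = y.
Proof.
move=> [A [EA <-]] [C [EC <-]] H; apply: PGL_piP.
case: H => -[ep eq er es]; [exists 1|exists (-1)]; rewrite EA EC scalar_mx2 mul_mx2 ep eq er es;
  congr mx2; ring.
Qed.

Lemma represents_opp x p q r s : represents x p q r s -> represents x (- p) (- q) (- r) (- s).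
Proof.
move=> Rx; have [|y Ry] := @represents_mk (- p) (- q) (- r) (- s).
  by have := represents_det Rx; congr pm1; ring.
suff -> : x = y by [].
by apply: (represents_eq Rx Ry); right; rewrite !opprK.
Qed.
End Matrices.

(** * The Farey tree of PGL(2,Z) *)

Section FareyData.
Implicit Types (p q r s : int) (x y : PGL 2 int).

Lemma det_a : pm1 (-1 * 1 - 0 * 0). Proof. by right. Qed.
Lemma det_b : pm1 (0 * 0 - 1 * 1). Proof. by right. Qed.
Lemma det_U : pm1 (1 * 1 - 1 * 0). Proof. by left. Qed.
Lemma det_L : pm1 (1 * 1 - 0 * 1). Proof. by left. Qed.

Definition gl2 p q r s (H : pm1 (p * s - q * r)) : GL 2 int := MkGL ((unit_mx2 p q r s).2 H).
Definition pgl2 p q r s (H : pm1 (p * s - q * r)) : PGL 2 int := \pi_(PGL 2 int)%qT (gl2 H).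

Lemma represents_pgl2 p q r s (H : pm1 (p * s - q * r)) : represents (pgl2 H) p q r s.
Proof. by exists (gl2 H). Qed.

Definition pa := pgl2 det_a.
Definition pb := pgl2 det_b.
Definition psh (c : bool) := if c then pgl2 det_U else pgl2 det_L.

Local Notation N := (@N _ pb psh).

Lemma rep_a : represents pa (-1) 0 0 1. Proof. exact: represents_pgl2. Qed.
Lemma rep_b : represents pb 0 1 1 0. Proof. exact: represents_pgl2. Qed.
Lemma rep_U : represents (psh true) 1 1 0 1. Proof. exact: represents_pgl2. Qed.
Lemma rep_L : represents (psh false) 1 0 1 1. Proof. exact: represents_pgl2. Qed.

Lemma pgl_aa : (pa * pa = 1)%g.
Proof. by apply: (represents_eq (representsM rep_a rep_a) represents1); left. Qed.
Lemma pgl_bb : (pb * pb = 1)%g.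
Proof. by apply: (represents_eq (representsM rep_b rep_b) represents1); left. Qed.
Lemma pgl_ab : (pa * pb = pb * pa)%g.
Proof. by apply: (represents_eq (representsM rep_a rep_b) (representsM rep_b rep_a)); right. Qed.
Lemma pgl_b_sh c : (pb * psh c = psh (~~ c) * pb)%g.
Proof.
case: c.
  by apply: (represents_eq (representsM rep_b rep_U) (representsM rep_L rep_b)); left.
by apply: (represents_eq (representsM rep_b rep_L) (representsM rep_U rep_b)); left.
Qed.
Lemma pgl_sh_a_same c : (psh c * pa * psh c = pa)%g.
Proof.
case: c.
  by apply: (represents_eq (representsM (representsM rep_U rep_a) rep_U) rep_a); left.
by apply: (represents_eq (representsM (representsM rep_L rep_a) rep_L) rep_a); left.
Qed.
Lemma pgl_sh_a_diff c : (psh c * pa * psh (~~ c) = psh (~~ c) * pb)%g.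
Proof.
case: c.
  by apply: (represents_eq (representsM (representsM rep_U rep_a) rep_L) (representsM rep_L rep_b)); left.
by apply: (represents_eq (representsM (representsM rep_L rep_a) rep_U) (representsM rep_U rep_b)); right; split; ring.
Qed.

Definition nonneg_rep x := exists p q r s, [/\ represents x p q r s, 0 <= p, 0 <= q, 0 <= r & 0 <= s].

Lemma nonneg_repM x y : nonneg_rep x -> nonneg_rep y -> nonneg_rep (x * y)%g.
Proof.
move=> [p [q [r [s [Rx p0 q0 r0 s0]]]]] [p' [q' [r' [s' [Ry p0' q0' r0' s0']]]]].
do 4!eexists; split; first exact: representsM Rx Ry.
all: by rewrite addr_ge0 // mulr_ge0.
Qed.

Lemma N_nonneg x : N x -> nonneg_rep x.
Proof.
have n1 : nonneg_rep 1%g by exists 1, 0, 0, 1; split=> //; apply: represents1.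
move=> [w [e ->]]; apply: nonneg_repM.
  elim: w => [//|c w IH] /=; apply: nonneg_repM IH.
  by case: c; [exists 1, 1, 0, 1|exists 1, 0, 1, 1]; split=> //; [apply: rep_U|apply: rep_L].
by case: e; rewrite ?expg0 ?expg1 //; exists 0, 1, 1, 0; split=> //; apply: rep_b.
Qed.

Lemma pgl_children_disjoint n m : N n -> N m -> (psh true * n <> psh false * m)%g.
Proof.
move=> /N_nonneg[p [q [r [s [Rn p0 q0 r0 s0]]]]] /N_nonneg[p' [q' [r' [s' [Rm p0' q0' r0' s0']]]]] E.
have RU := representsM rep_U Rn; rewrite E in RU.
have dn := represents_det Rn; have dm := represents_det Rm.
case: (represents_uniq RU (representsM rep_L Rm)); rewrite !mul1r !mul0r !addr0 !add0r => -[e1 e2 e3 e4].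
  have ep : p = 0 by lia.
  have eq : q = 0 by lia.
  by case: dn; rewrite ep eq !mul0r.
have ep : p = 0 by lia.
have eq : q = 0 by lia.
by case: dn; rewrite ep eq !mul0r.
Qed.

Lemma pgl_complement_disjoint n m : N n -> N m -> (n <> pa * m)%g.
Proof.
move=> /N_nonneg[p [q [r [s [Rn p0 q0 r0 s0]]]]] /N_nonneg[p' [q' [r' [s' [Rm p0' q0' r0' s0']]]]] E.
have RU := representsM rep_a Rm; rewrite -E in RU.
have dn := represents_det Rn.
case: (represents_uniq Rn RU); rewrite !mul1r !mul0r !addr0 !add0r !mulN1r => -[e1 e2 e3 e4].
  have ep : p = 0 by lia.
  have eq : q = 0 by lia.
  by case: dn; rewrite ep eq !mul0r.
have er : r = 0 by lia.
have es : s = 0 by lia.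
by case: dn; rewrite er es !mulr0.
Qed.

(** Since p s >= (r + 1) (q + 1), the determinant is at least q + r + 1. *)
Lemma gap_det p q r s : r < p -> q < s -> 0 <= q -> 0 <= r -> pm1 (p * s - q * r) ->
  [/\ p = 1, q = 0, r = 0 & s = 1].
Proof.
move=> rp qs q0 r0 d.
have H : (r + 1) * (q + 1) <= p * s by apply: ler_pM; lia.
have E : (r + 1) * (q + 1) = q * r + (q + r) + 1 by ring.
have q0' : q = 0 by case: d => d; lia.
have r0' : r = 0 by case: d => d; lia.
have ps : p * s = 1 by move: d; rewrite q0' mul0r subr0 => -[//|]; nia.
have p1 : p <= p * s by rewrite ler_peMr; lia.
have s1 : s <= p * s by rewrite ler_peMl; lia.
by split; lia.
Qed.

(** Euclid's algorithm on the rows: a nonnegative matrix of determinant 1 or -1 whose rows are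
    comparable factors through a shear, and by [gap_det] the only ones with incomparable rows
    are the identity and the transposition. *)
Lemma nonneg_N k x p q r s : represents x p q r s -> 0 <= p -> 0 <= q -> 0 <= r -> 0 <= s ->
  p + q + r + s <= k%:Z -> N x.
Proof.
elim: k x p q r s => [|k IH] x p q r s Rx p0 q0 r0 s0 H; have d := represents_det Rx.
  have ep : p = 0 by lia.
  have eq : q = 0 by lia.
  by case: d; rewrite ep eq !mul0r.
have NN n m : N n -> N m -> N (n * m)%g by move=> Nn Nm; exact: (NM pgl_bb pgl_b_sh Nn Nm).
have [/andP[rp sq]|] := boolP ((r <= p) && (s <= q)).
  have rs0 : 0 < r + s.
    case: (ltP 0 (r + s)) => // rs.
    have er : r = 0 by lia.
    have es : s = 0 by lia.
    by case: d; rewrite er es !mulr0.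
  have [|y Ry] := @represents_mk (p - r) (q - s) r s.
    by move: d; congr pm1; ring.
  have -> : x = (psh true * y)%g.
    apply: (represents_eq Rx (representsM rep_U Ry)); left; split; ring.
  apply: NN; first exact: Nsh.
  by apply: (IH _ _ _ _ _ Ry); lia.
have [/andP[rp sq] _|n1 n2] := boolP ((p <= r) && (q <= s)).
  have rs0 : 0 < p + q.
    case: (ltP 0 (p + q)) => // rs.
    have er : p = 0 by lia.
    have es : q = 0 by lia.
    by case: d; rewrite er es !mul0r.
  have [|y Ry] := @represents_mk p q (r - p) (s - q).
    by move: d; congr pm1; ring.
  have -> : x = (psh false * y)%g.
    apply: (represents_eq Rx (representsM rep_L Ry)); left; split; ring.
  apply: NN; first exact: Nsh.
  by apply: (IH _ _ _ _ _ Ry); lia.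
have [rp'|pr] := ltP r p.
  have qs : q < s by lia.
  have [ep eq er es] := gap_det rp' qs q0 r0 d.
  rewrite ep eq er es in Rx.
  have -> : x = 1%g by apply: (represents_eq Rx represents1); left.
  exact: N1.
have pr' : p < r by lia.
have sq : s < q by lia.
have d' : pm1 (r * q - s * p) by case: d => d; [right|left]; lia.
have [er es ep eq] := gap_det pr' sq s0 p0 d'.
rewrite ep eq er es in Rx.
have -> : x = pb by apply: (represents_eq Rx rep_b); left.
exact: Nb.
Qed.

Lemma nonneg_rep_N x : nonneg_rep x -> N x.
Proof.
move=> [p [q [r [s [Rx p0 q0 r0 s0]]]]].
by apply: (nonneg_N (k := absz (p + q + r + s)) Rx) => //; lia.
Qed.

(** If the four signs could not be made equal by flipping a row and a column, p s and q r would
    be nonzero of opposite signs and p s - q r would have absolute value at least 2. *)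
Lemma sign_cover p q r s : pm1 (p * s - q * r) ->
  exists i j : bool, let e := (-1) ^+ i in let f := (-1) ^+ j in
    [/\ 0 <= e * f * p, 0 <= e * q, 0 <= f * r & 0 <= s] \/
    [/\ e * f * p <= 0, e * q <= 0, f * r <= 0 & s <= 0].
Proof.
move=> d.
suff : [\/ [/\ 0 <= p, 0 <= q, 0 <= r & 0 <= s] \/ [/\ p <= 0, q <= 0, r <= 0 & s <= 0],
          [/\ p <= 0, q <= 0, 0 <= r & 0 <= s] \/ [/\ 0 <= p, 0 <= q, r <= 0 & s <= 0],
          [/\ p <= 0, 0 <= q, r <= 0 & 0 <= s] \/ [/\ 0 <= p, q <= 0, 0 <= r & s <= 0]
        | [/\ 0 <= p, q <= 0, r <= 0 & 0 <= s] \/ [/\ p <= 0, 0 <= q, 0 <= r & s <= 0]].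
  case=> H; [exists false, false|exists true, false|exists false, true|exists true, true];
    rewrite /= ?expr0 ?expr1 ?mulrNN ?mul1r ?mulN1r ?mulr1 ?mulrN1 ?mulN1r; case: H => -[? ? ? ?]; by [left; split; lia|right; split; lia].
have bad u v : 0 < u -> v < 0 -> pm1 (u - v) -> False by move=> ? ? []; lia.
have d' : pm1 (q * r - p * s) by case: d => d; [right|left]; lia.
case: (ltrgtP p 0) => p0; case: (ltrgtP q 0) => q0; case: (ltrgtP r 0) => r0; case: (ltrgtP s 0) => s0;
 first [by apply: Or41; left; split; lia|by apply: Or41; right; split; lia
  |by apply: Or42; left; split; lia|by apply: Or42; right; split; lia
  |by apply: Or43; left; split; lia|by apply: Or43; right; split; lia
  |by apply: Or44; left; split; lia|by apply: Or44; right; split; lia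
  |by exfalso; apply: (bad (p * s) (q * r)) => //; nia
  |by exfalso; apply: (bad (q * r) (p * s)) => //; nia].
Qed.

Lemma pgl_orientation_cover x : exists i j : bool, N (pa ^+ i * x * pa ^+ j)%g.
Proof.
have [p [q [r [s Rx]]]] := represents_exists x.
have [i [j H]] := sign_cover (represents_det Rx); exists i, j; apply: nonneg_rep_N.
have Ra (k : bool) : represents (pa ^+ k)%g ((-1) ^+ k) 0 0 1.
  by case: k; [exact: rep_a|exact: represents1].
have R := representsM (representsM (Ra i) Rx) (Ra j).
case: H => -[Hp Hq Hr Hs].
- do 4!eexists; split; first exact: R.
  all: rewrite ?(mul0r, mul1r, mulr0, mulr1, addr0, add0r) ?(mulrAC _ p) ?(mulrC r) //.
- do 4!eexists; split; first exact: represents_opp R.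
  all: rewrite ?(mul0r, mul1r, mulr0, mulr1, addr0, add0r, oppr_ge0) ?(mulrAC _ p) ?(mulrC r) //.
Qed.
End FareyData.

(** * The lower bound *)

Section Padovan.
Variable R : realType.

Lemma padovan_root_exists : exists al : R, 0 < al /\ al ^+ 3 = al + 1.
Proof.
have [||al a12 /rootP] := @poly_ivt R ('X^3 - 'X - 1) 1 2.
- by lra.
- by rewrite !hornerE; apply/andP; split; lra.
rewrite !hornerE => E; exists al; split; last by lra.
by case/andP: a12; lra.
Qed.

Lemma padovan_gt1 (x : R) : 0 < x -> x ^+ 3 = x + 1 -> 1 < x.
Proof.
move=> x0 ex; have [//|x1] := ltP 1 x.
by have : x ^+ 3 <= x; [rewrite exprS ger_pMr // expr_le1 // ltW|lra].
Qed.

(** Dividing the difference of the two equations by x - y leaves x^2 + x y + y^2 = 1, which is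
    impossible for x > 1. *)
Lemma padovan_root_uniq (x y : R) : 0 < x -> 0 < y -> x ^+ 3 = x + 1 -> y ^+ 3 = y + 1 -> x = y.
Proof.
move=> x0 y0 ex ey; have x1 := padovan_gt1 x0 ex.
have : (x - y) * (x ^+ 2 + x * y + y ^+ 2 - 1) = 0.
  have -> : (x - y) * (x ^+ 2 + x * y + y ^+ 2 - 1) = (x ^+ 3 - x) - (y ^+ 3 - y) by ring.
  by rewrite ex ey; ring.
move/eqP; rewrite mulf_eq0 => /orP[/eqP|/eqP]; first by lra.
by move=> E; exfalso; nra.
Qed.

Variables (al : R).
Hypotheses (al0 : 0 < al) (al3 : al ^+ 3 = al + 1).

Lemma padovan_rec n : al ^+ n.+3 = al ^+ n.+1 + al ^+ n.
Proof. by rewrite -addn3 exprD al3 mulrDr mulr1 -exprSr. Qed.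

(** Give the two letters the weights 2 and 3.  The words of weight at most n have values in the
    ball of radius n, and their number grows at least by the recurrence of the powers of alpha. *)
Lemma growth_rate_free_pair (G : groupType) (S : set G) (x y : G) :
  finite_set S -> generates S -> word_ball S 2 x -> word_ball S 3 y -> free_pair x y ->
  al <= growth_rate R S.
Proof.
move=> Sf Sg Bx By F.
apply: (growth_lim_ge (growth_gt0 Sg Sf) (growth_submul Sg Sf) al0 (exprn_gt0 2 al0)) => n.
have [s [us sB sn]] : exists s : seq (seq bool), [/\ uniq s,
    forall w, w \in s -> word_ball S n (eval_pair x y w) & al ^+ n <= al ^+ 2 * (size s)%:R].
  elim/ltn_ind: n => -[|[|[|n]]] IH.
  1-3: exists [:: [::]]; split=> // [w|]; first by rewrite inE => /eqP -> /=; apply: word_ball1.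
  1-3: by rewrite mulr1 ler_weXn2l // ltW // (padovan_gt1 al0 al3).
  have [|s [us sB sn]] := IH n.+1; first by lia.
  have [|t [ut tB tn]] := IH n; first by lia.
  exists (map (cons true) s ++ map (cons false) t); split.
  - rewrite cat_uniq !map_inj_uniq ?us ?ut //=; try by move=> u v [].
    by rewrite andbT; apply/hasPn => _ /mapP[u _ ->]; apply/mapP => -[v].
  - move=> w; rewrite mem_cat => /orP[] /mapP[u us' ->] /=.
      by have := word_ballM Sg Bx (sB u us').
    by have := word_ballM Sg By (tB u us').
  - by rewrite size_cat !size_map natrD mulrDr padovan_rec lerD.
apply: (le_trans sn); rewrite ler_pM2l ?exprn_gt0 // ler_nat -(size_map (eval_pair x y)).
apply: growth_ge => //; first by rewrite map_inj_uniq.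
by move=> _ /mapP[w /sB Bw ->].
Qed.

Lemma pgl_growth_rate_ge (S : set (PGL 2 int)) : finite_set S -> generates S ->
  al <= growth_rate R S.
Proof.
move=> Sf Sg.
have [x [y [Bx By F]]] := short_free_pair_exists pgl_aa pgl_bb pgl_ab pgl_b_sh pgl_sh_a_same pgl_sh_a_diff
  pgl_children_disjoint pgl_complement_disjoint pgl_orientation_cover Sg.
exact: growth_rate_free_pair Bx By F.
Qed.
End Padovan.

(** * Normal forms for the Coxeter generators of GL(2,Z) *)

Section NormalForms.
Implicit Types (g : GL 2 int) (w : seq bool) (y : option bool) (k e i s : bool).
Local Open Scope group_scope.

Lemma det_c : pm1 (-1 * 1 - -1 * 0). Proof. by right. Qed.
Lemma det_z : pm1 (-1 * -1 - 0 * 0). Proof. by left. Qed.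

Let A : GL 2 int := gl2 det_a.
Let B : GL 2 int := gl2 det_b.
Let C : GL 2 int := gl2 det_c.
Let Z : GL 2 int := gl2 det_z.

(** Lifts of the reflections in the sides of the (2,3,infinity) triangle. *)
Definition coxeter_gens : set (GL 2 int) := [set A; B; C].

Lemma gl2_ext g h : GLmx g = GLmx h -> g = h.
Proof. exact: val_inj. Qed.

Ltac gl_compute := apply: gl2_ext; rewrite ?GLmxM ?GLmx1 ?scalar_mx2 /= ?mul_mx2; congr mx2; ring.

Lemma glAA : A * A = 1. Proof. by gl_compute. Qed.
Lemma glBB : B * B = 1. Proof. by gl_compute. Qed.
Lemma glCC : C * C = 1. Proof. by gl_compute. Qed.
Lemma glZZ : Z * Z = 1. Proof. by gl_compute. Qed.
Lemma glBA : B * A = Z * A * B. Proof. by gl_compute. Qed.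
Lemma glCBC : C * B * C = B * C * B. Proof. by gl_compute. Qed.
Lemma glZC g : g * Z = Z * g.
Proof. by apply: gl2_ext; rewrite !GLmxM /= (mx2_eta (GLmx g)) !mul_mx2; congr mx2; ring. Qed.

(** Nontrivial representatives of the cosets x <B> in the dihedral group of order 6 generated
    by B and C. *)
Definition syllable k : GL 2 int := if k then C else B * C.
Definition tail y e : GL 2 int := (if y is Some k then syllable k else 1) * B ^+ e.
Definition syllables w : GL 2 int := foldr (fun k g => syllable k * A * g) 1 w.
(** The normal form for the amalgam of <A, B> and <B, C> along <B>, up to the sign Z^s. *)
Definition normal_form s i w y e : GL 2 int := Z ^+ s * A ^+ i * syllables w * tail y e.
Definition syllables_wt w : nat := foldr (fun k n => (if k then 2 else 3) + n)%N 0%N w.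
Definition tail_wt y : nat := if y is Some k then if k then 1%N else 2%N else 0%N.

Lemma B_syllable k : B * syllable k = syllable (~~ k).
Proof. by case: k; rewrite //= mulgA glBB mul1g. Qed.

(** Multiplying by B exchanges C and BC in the first syllable, or changes the sign of the tail. *)
Lemma B_normal w y e : exists w' y' e',
  B * (syllables w * tail y e) = syllables w' * tail y' e' /\
  (syllables_wt w' + tail_wt y' <= syllables_wt w + tail_wt y + 1)%N.
Proof.
case: w => [|k w].
  case: y => [k|].
    exists [::], (Some (~~ k)), e; rewrite /tail !mul1g mulgA B_syllable; split=> //.
    by case: k.
  exists [::], None, (~~ e); rewrite /tail /= !mul1g; split=> //.
  by case: e; rewrite /= ?expg1 ?expg0 ?mulg1 ?glBB.
exists (~~ k :: w), y, e; split; first by rewrite /= -(B_syllable k) !mulgA.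
by case: k => /=; lia.
Qed.

Lemma normalE s i w y e : normal_form s i w y e = Z ^+ s * (A ^+ i * (syllables w * tail y e)).
Proof. by rewrite /normal_form !mulgA. Qed.

Lemma Z_normal s i w y e : Z * normal_form s i w y e = normal_form (~~ s) i w y e.
Proof.
by rewrite !normalE mulgA; case: s; rewrite /= ?expg1 ?expg0 ?glZZ ?mulg1.
Qed.

Lemma ZX_comm s g : g * Z ^+ s = Z ^+ s * g.
Proof. by case: s; rewrite ?expg1 ?expg0 ?mulg1 ?mul1g // glZC. Qed.

(** Each letter costs its length, except that the factors Z and the final power of B are free. *)
Definition normal_ball n g := exists s i w y e,
  g = normal_form s i w y e /\ (i + syllables_wt w + tail_wt y <= n)%N.

Lemma normal_ballZ n s g : normal_ball n g -> normal_ball n (Z ^+ s * g).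
Proof.
case: s; rewrite ?expg0 ?mul1g // expg1 => -[s [i [w [y [e [-> H]]]]]].
by exists (~~ s), i, w, y, e; rewrite Z_normal.
Qed.

Lemma normal_ball_core n (i : bool) w y e : (i + syllables_wt w + tail_wt y <= n)%N ->
  normal_ball n (A ^+ i * (syllables w * tail y e)).
Proof. by move=> H; exists false, i, w, y, e; rewrite normalE expg0 mul1g. Qed.

(** The only case that reaches beyond the first syllable is C (B C A) = B C B A = Z (B C A) B,
    where the factor B is absorbed by the next syllable. *)
Lemma normal_ball_gen n x g : coxeter_gens x -> normal_ball n g -> normal_ball n.+1 (x * g).
Proof.
move=> Sx [s [i [w [y [e [-> H]]]]]].
rewrite normalE mulgA ZX_comm -mulgA; apply: normal_ballZ.
case: Sx => [[->|->]|->].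
- case: i H => H; rewrite ?expg1 ?expg0 ?mul1g.
    rewrite mulgA glAA mul1g -[_ * _]mul1g -[1](expg0 A).
    by apply: (@normal_ball_core _ false); move: H; rewrite /=; lia.
  by rewrite -[X in X * _]expg1; apply: (@normal_ball_core _ true); move: H; rewrite /=; lia.
- have [w' [y' [e' [E H']]]] := B_normal w y e.
  case: i H => H; rewrite ?expg1 ?expg0 ?mul1g.
    rewrite mulgA glBA -!mulgA E -[Z]expg1; apply: (normal_ballZ true).
    by rewrite -[X in X * _]expg1; apply: (@normal_ball_core _ true); move: H; rewrite /=; lia.
  rewrite E -[_ * _]mul1g -[1](expg0 A).
  by apply: (@normal_ball_core _ false); move: H; rewrite /=; lia.
- case: i H => H; rewrite ?expg1 ?expg0 ?mul1g.
    have -> : C * (A * (syllables w * tail y e)) = A ^+ false * (syllables (true :: w) * tail y e).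
      by rewrite expg0 mul1g /= !mulgA.
    by apply: normal_ball_core; move: H; rewrite /=; lia.
  case: w H => [|[] w] H.
  + case: y H => [[]|] H; rewrite /tail /= !mul1g.
    * rewrite mulgA glCC mul1g.
      have -> : B ^+ e = A ^+ false * (syllables [::] * tail None e).
        by rewrite /tail /= expg0 !mul1g.
      by apply: normal_ball_core; rewrite /=; lia.
    * have -> : C * (B * C * B ^+ e) = A ^+ false * (syllables [::] * tail (Some false) (~~ e)).
        rewrite /tail /= expg0 !mul1g !mulgA glCBC -!mulgA; congr (_ * (_ * _)).
        by case: (e); rewrite /= ?expg1 ?expg0 ?mulg1 ?glBB.
      by apply: normal_ball_core; move: H; rewrite /=; lia.
    * have -> : C * B ^+ e = A ^+ false * (syllables [::] * tail (Some true) e).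
        by rewrite /tail /= expg0 !mul1g.
      by apply: normal_ball_core; move: H; rewrite /=; lia.
  + have -> : C * (syllables (true :: w) * tail y e) = A ^+ true * (syllables w * tail y e).
      by rewrite expg1 /= !mulgA glCC mul1g.
    by apply: normal_ball_core; move: H; rewrite /=; lia.
  + have [w' [y' [e' [E H']]]] := B_normal w y e.
    have -> : C * (syllables (false :: w) * tail y e) =
        Z ^+ true * (A ^+ false * (syllables (false :: w') * tail y' e')).
      rewrite expg0 mul1g expg1 /= -(mulgA (B * C * A) (syllables w')) -E !mulgA glCBC.
      by rewrite -(mulgA (B * C) B) glBA !mulgA (glZC (B * C)) !mulgA.
    by apply/normal_ballZ/normal_ball_core; move: H; rewrite /=; lia.
Qed.

Lemma coxeter_letters x : letters coxeter_gens x -> coxeter_gens x.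
Proof.
case=> [//|[g Sg <-]]; suff -> : g^-1 = g by [].
by apply: mulg1_eq; case: Sg => [[->|->]|->]; rewrite ?glAA ?glBB ?glCC.
Qed.

Lemma is_product_normal n g : is_product coxeter_gens g n -> normal_ball n g.
Proof.
move=> [w [<- lw <-]]; elim: w lw => [|x w IH] lw.
  rewrite big_nil; exists false, false, [::], None, false; split=> //.
  by rewrite /normal_form /tail /= !expg0 !mul1g.
rewrite big_cons; apply: normal_ball_gen; first exact/coxeter_letters/lw/mem_head.
by apply: IH => z zw; apply: lw; rewrite inE zw orbT.
Qed.

(** The shears and the transposition are products of A, B, C, so by [pgl_orientation_cover] every
    matrix is such a product up to the sign Z = (A B)^2. *)
Lemma coxeter_generates : generates coxeter_gens.
Proof.
pose P g := exists n, is_product coxeter_gens g n.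
have P1 : P 1 by exists 0%N; apply: is_product1.
have PM x x' : P x -> P x' -> P (x * x').
  by move=> [n Px] [m Py]; exists (n + m)%N; apply: is_productM.
have Pg x : coxeter_gens x -> P x by move=> Sx; exists 1%N; apply/is_product_letter; left.
have PA : P A by apply: Pg; left; left.
have PB : P B by apply: Pg; left; right.
have PC : P C by apply: Pg; right.
have PZ : P Z.
  have -> : Z = A * B * (A * B) by gl_compute.
  exact: (PM _ _ (PM _ _ PA PB) (PM _ _ PA PB)).
have PX x (k : bool) : P x -> P (x ^+ k) by case: k; rewrite ?expg1 ?expg0.
pose Q x := exists2 h, P h & \pi_(PGL 2 int)%qT h = x.
have Q1 : Q 1 by exists 1 => //; apply: PGL_pi1.
have QM x x' : Q x -> Q x' -> Q (x * x').
  by move=> [g Pg' <-] [h Ph <-]; exists (g * h); [apply: PM|apply: PGL_piM].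
have Qlt k : Q (psh k).
  case: k; [exists (A * C); first exact: PM|exists (B * (A * C) * B);
    first exact: (PM _ _ (PM _ _ PB (PM _ _ PA PC)) PB)].
    by congr (\pi_(PGL 2 int)%qT _); gl_compute.
  by congr (\pi_(PGL 2 int)%qT _); gl_compute.
have QX x (k : bool) : Q x -> Q (x ^+ k) by case: k; rewrite ?expg1 ?expg0.
have Qa : Q pa by exists A.
have Qb : Q pb by exists B.
move=> g; have [h Ph E] : Q (\pi_(PGL 2 int)%qT g).
  have [i [j [w [e E]]]] := pgl_orientation_cover (\pi_(PGL 2 int)%qT g).
  have -> : \pi_(PGL 2 int)%qT g = pa ^+ i * nf pb psh w e * pa ^+ j.
    rewrite -E !mulgA; case: i j {E} => [] [];
    by rewrite ?expg1 ?expg0 ?mul1g ?mulg1 ?pgl_aa ?mul1g -?mulgA ?pgl_aa ?mulg1.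
  have Qw : Q (word_prod psh w) by elim: w {E} => //= k w; apply: (QM).
  exact: (QM _ _ (QM _ _ (QX _ _ Qa) (QM _ _ Qw (QX _ _ Qb))) (QX _ _ Qa)).
have Rg : represents (\pi_(PGL 2 int)%qT g) (GLmx g 0%R 0%R) (GLmx g 0%R 1%R) (GLmx g 1%R 0%R) (GLmx g 1%R 1%R).
  by exists g; split=> //; apply: mx2_eta.
have Rh : represents (\pi_(PGL 2 int)%qT g) (GLmx h 0%R 0%R) (GLmx h 0%R 1%R) (GLmx h 1%R 0%R) (GLmx h 1%R 1%R).
  by exists h; split=> //; apply: mx2_eta.
case: (represents_uniq Rg Rh) => -[e1 e2 e3 e4].
  have -> : g = h by apply: gl2_ext; rewrite (mx2_eta (GLmx g)) (mx2_eta (GLmx h)) e1 e2 e3 e4.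
  exact: Ph.
have -> : g = Z * h.
  apply: gl2_ext; rewrite GLmxM (mx2_eta (GLmx g)) (mx2_eta (GLmx h)) e1 e2 e3 e4 /= mul_mx2.
  by congr mx2; ring.
exact: PM.
Qed.

Lemma finite_coxeter_gens : finite_set coxeter_gens.
Proof. by rewrite /coxeter_gens; apply: finite_set3. Qed.

Lemma word_ball_normal n g : word_ball coxeter_gens n g -> normal_ball n g.
Proof.
move=> /(word_ballP coxeter_generates)[k kn /is_product_normal].
by move=> [s [i [w [y [e [-> H]]]]]]; exists s, i, w, y, e; split=> //; lia.
Qed.

(** Besides its syllables, a normal form has two choices for each of s and i and six tails. *)
Lemma coxeter_growth_le n (ws : seq (seq bool)) :
  (forall w, (syllables_wt w <= n)%N -> w \in ws) -> (growth coxeter_gens n <= 24 * size ws)%N.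
Proof.
move=> Hws.
pose bs := [:: true; false].
pose ts := [seq tail y e | y <- [:: None; Some true; Some false], e <- bs].
pose hs := [seq Z ^+ nat_of_bool s * A ^+ nat_of_bool i | s <- bs, i <- bs].
pose L := [seq p * t | p <- [seq h * syllables w | h <- hs, w <- ws], t <- ts].
have -> : (24 * size ws = size L)%N by rewrite /L !size_allpairs /=; lia.
apply: growth_le => [||g]; [exact: coxeter_generates|exact: finite_coxeter_gens|].
move=> /word_ball_normal[s [i [w [y [e [-> H]]]]]].
have inb k : k \in bs by case: k.
have inh : Z ^+ s * A ^+ i \in hs.
  exact: (allpairs_f (fun s i : bool => Z ^+ s * A ^+ i) (inb s) (inb i)).
have int : tail y e \in ts.
  by apply: (allpairs_f tail _ (inb e)); case: (y) => [[]|].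
have inw : w \in ws by apply: Hws; lia.
exact: (allpairs_f _ (allpairs_f (fun h w => h * syllables w) inh inw) int).
Qed.
End NormalForms.

(** * The upper bound *)

Section UpperBound.
Variables (R : realType) (al : R).
Hypotheses (al0 : 0 < al) (al3 : al ^+ 3 = al + 1).

(** The additional 1 makes the bound stable: the list for n.+3 consists of the empty word and
    the lists for n.+1 and n preceded by a syllable. *)
Lemma syllable_words n : exists ws : seq (seq bool),
  (forall w, (syllables_wt w <= n)%N -> w \in ws) /\ (size ws)%:R + 1 <= 3 * al ^+ n.
Proof.
have al1 := padovan_gt1 al0 al3.
have base m : 1 <= al ^+ m by rewrite exprn_ege1 // ltW.
elim/ltn_ind: n => -[|[|[|n]]] IH.
- exists [:: [::]]; split=> [[|[] w]|] //; rewrite /= expr0; lra.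
- exists [:: [::]]; split=> [[|[] w]|] //=; have := base 1%N; lra.
- exists [:: [::]; [:: true]]; split=> [[|[] [|[] w]]|] //=; have := base 2; lra.
have [|s [sB sn]] := IH n.+1; first by lia.
have [|t [tB tn]] := IH n; first by lia.
exists ([::] :: map (cons true) s ++ map (cons false) t); split.
  move=> [//|[] w] /= H; rewrite inE mem_cat; apply/orP; right; apply/orP; [left|right];
    by apply: map_f; [apply: sB || apply: tB]; lia.
rewrite /= size_cat !size_map padovan_rec // -addn1 !natrD.
by lra.
Qed.

Lemma coxeter_growth_rate_le : growth_rate R coxeter_gens <= al.
Proof.
have Sg := coxeter_generates; have Sf := finite_coxeter_gens.
(* The factor 24 of [coxeter_growth_le] times the factor 3 of [syllable_words]. *)
have C0 : 0 < 72 :> R by lra.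
apply: (growth_lim_le (growth_gt0 Sg Sf) (growth_submul Sg Sf) al0 C0) => n.
have [ws [wsB wsn]] := syllable_words n.
have := coxeter_growth_le wsB; rewrite -(ler_nat R) natrM => H.
by apply: (le_trans H); lra.
Qed.
End UpperBound.

(** * The minimal growth rates *)

Lemma min_growth_rateE (R : realType) (G : groupType) (al : R) (S0 : set G) :
  (forall S : set G, finite_set S -> generates S -> al <= growth_rate R S) ->
  finite_set S0 -> generates S0 -> growth_rate R S0 <= al -> min_growth_rate R G = al.
Proof.
move=> al_le S0f S0g le_al; apply/eqP; rewrite eq_le; apply/andP; split.
  apply: le_trans le_al; apply: ge_inf; last by exists S0.
  by exists al => _ [S [Sf Sg] <-]; apply: al_le.
apply: lb_le_inf; first by exists (growth_rate R S0), S0.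
by move=> _ [S [Sf Sg] <-]; apply: al_le.
Qed.

Theorem mainTheorem3 (R : realType) :
  exists alpha : R,
    unique (fun z : R => 0 < z /\ root ('X^3 - 'X - 1) z) alpha /\
    min_growth_rate R (PGL 2 int) = min_growth_rate R (GL 2 int) /\
    min_growth_rate R (GL 2 int) = alpha.
Proof.
have [al [al0 al3]] := padovan_root_exists R.
have rootE (z : R) : root ('X^3 - 'X - 1) z <-> z ^+ 3 = z + 1.
  by rewrite /root !hornerE; split=> [/eqP|H]; [lra|apply/eqP; lra].
pose pi (g : GL 2 int) : PGL 2 int := \pi_(PGL 2 int)%qT g.
have piM : {morph pi : x y / (x * y)%g >-> (x * y)%g} by move=> x y; apply: PGL_piM.
have pi_surj y : exists x, pi x = y by elim/quotW: y => x; exists x.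
have cox_le := coxeter_growth_rate_le al0 al3.
have cox_gen := coxeter_generates; have cox_fin := finite_coxeter_gens.
have pgl_min : min_growth_rate R (PGL 2 int) = al.
  apply: (@min_growth_rateE _ _ _ [set pi x | x in coxeter_gens]).
  - by move=> S Sf Sg; apply: pgl_growth_rate_ge.
  - exact: finite_image.
  - exact: image_generates.
  - exact: le_trans (growth_rate_image_le piM pi_surj cox_gen cox_fin R) cox_le.
have gl_min : min_growth_rate R (GL 2 int) = al.
  apply: (@min_growth_rateE _ _ _ coxeter_gens) => // S Sf Sg.
  apply: le_trans (growth_rate_image_le piM pi_surj Sg Sf R).
  by apply: pgl_growth_rate_ge => //; [exact: finite_image|exact: image_generates].
exists al; split; last by rewrite pgl_min gl_min.
split; first by split=> //; apply/rootE.
by move=> z [z0 /rootE z3]; apply: padovan_root_uniq.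
Qed.
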